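(* Let $G=[g_1,g_2,\ldots]$ be a transcendental semigroup. Then $J(G)\cup\{\infty\}$ is connected as a subset of the Riemann sphere $\widetilde{\mathbb{C}}$ if and only if the Fatou set $F(G)$ has no multiply connected components.
   Context: A transcendental semigroup $G=[g_1,g_2,\ldots]$ is the set of all finite compositions (of length at least one) of members of a countable (finite or infinite) family $\{g_1,g_2,\ldots\}$ of transcendental entire functions. $\widetilde{\mathbb{C}}=\mathbb{C}\cup\{\infty\}$ is the Riemann sphere. The Fatou set $F(G)$ is the largest open subset of $\mathbb{C}$ on which the family $G$ is normal (every sequence in $G$ has a subsequence converging locally uniformly to a holomorphic function or to $\infty$). The Julia set is $J(G)=\widetilde{\mathbb{C}}\setminus F(G)$. Components of $F(G)$ are its connected components; a component is multiply connected if it is not simply connected. *)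

(* Defs.v *)
From HB Require Import structures.
From mathcomp Require Import all_boot all_order all_algebra.
From mathcomp Require Import all_classical all_reals all_analysis.
From mathcomp Require Import complex.

Set Implicit Arguments.
Unset Strict Implicit.
Unset Printing Implicit Defensive.

Import Order.TTheory GRing.Theory Num.Theory.
Import numFieldNormedType.Exports.

Local Open Scope classical_set_scope.
Local Open Scope ring_scope.
Local Open Scope complex_scope.

(** The complex plane, as a normed space over the field [R[i]]: the regular
    module [R[i]^o] carries the topology of the modulus, and [derivable f z 1]
    for [f : Cplane R -> Cplane R] is complex differentiability at [z]. *)
Notation Cplane R := (R[i]^o) (only parsing).

Notation Csphere R := (one_point_compactification (R[i]^o)) (only parsing).

Section EntireFunctions.
Variable R : realType.
Local Notation C := (Cplane R).
Implicit Types (f g : C -> C) (U : set C) (A G : set (C -> C)).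

Definition holomorphic_on U f := forall z : C, U z -> derivable f z 1.

Definition entire f := holomorphic_on setT f.

Definition transcendental_entire f :=
  entire f /\ ~ exists p : {poly R[i]}, forall z : C, f z = p.[z].

Inductive semigroup_generated_by A : set (C -> C) :=
| semigroup_gen f : A f -> semigroup_generated_by A f
| semigroup_comp f g : semigroup_generated_by A f ->
    semigroup_generated_by A g -> semigroup_generated_by A (f \o g).

Definition cvg_locally_uniformly U (f_ : nat -> C -> C) (h : C -> C) :=
  forall z : C, U z ->
    exists2 V : set C, nbhs z V & {uniform V `&` U, f_ @ \oo --> h}.

Definition cvg_locally_uniformly_infty U (f_ : nat -> C -> C) :=
  forall z : C, U z -> exists2 V : set C, nbhs z V &
    forall M : R, \forall n \near \oo,
      forall w : C, (V `&` U) w -> M%:C < `|f_ n w|.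

Definition normal_on U G :=
  forall f_ : nat -> C -> C, (forall n, G (f_ n)) ->
  exists phi : nat -> nat,
    {homo phi : m n / (m < n)%N} /\
    ((exists2 h : C -> C, holomorphic_on U h &
        cvg_locally_uniformly U (f_ \o phi) h) \/
     cvg_locally_uniformly_infty U (f_ \o phi)).

(** Normality is a local property, so the largest open set of normality is the
    union of all open sets of normality.  On a disconnected open set the limit
    may be holomorphic on one component and infinite on another, which
    [normal_on] does not cover; this does not affect the union. *)
Definition Fatou G : set C :=
  \bigcup_(U in [set U : set C | open U /\ normal_on U G]) U.

(** [None] is the point at infinity. *)
Definition Julia G : set (Csphere R) := ~` (Some @` Fatou G).

End EntireFunctions.

Section SimpleConnectedness.
Variables (R : realType) (T : topologicalType).
Implicit Types U D F : set T.

Definition path_in U (x y : T) (gamma : R -> T) :=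
  [/\ {within `[0, 1]%classic, continuous gamma}, gamma 0 = x, gamma 1 = y &
      forall t, t \in `[0, 1] -> U (gamma t)].

(** Homotopy relative to the base point: [H (t, s)] is the loop [gamma] at
    time [s = 0] and is constant at time [s = 1]. *)
Definition null_homotopic_in U (x : T) (gamma : R -> T) :=
  exists H : R * R -> T,
    [/\ {within `[0, 1]%classic `*` `[0, 1]%classic, continuous H},
        forall t s, t \in `[0, 1] -> s \in `[0, 1] -> U (H (t, s)),
        forall t, t \in `[0, 1] -> H (t, 0) = gamma t,
        forall t, t \in `[0, 1] -> H (t, 1) = x &
        forall s, s \in `[0, 1] -> H (0, s) = x /\ H (1, s) = x].

Definition simply_connected U :=
  (forall x y, U x -> U y -> exists gamma, path_in U x y gamma) /\
  (forall x gamma, path_in U x x gamma -> null_homotopic_in U x gamma).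

Definition multiply_connected U := ~ simply_connected U.

Definition component_of F D :=
  exists2 x, F x & D = connected_component F x.

End SimpleConnectedness.

Arguments multiply_connected R {T} U.
Arguments simply_connected R {T} U.

(* Main.v *)
(* Only the openness of the Fatou set U matters: the complement of an open plane
   set U in the sphere is connected iff every component of U is simply connected.

   If the complement of U is connected, a loop in U is homotopic to a closed walk
   on a fine square lattice.  Such a walk is contracted by pushing its topmost
   rightmost corner across the adjacent square.  This square lies in U: the parity
   of the number of crossings of a horizontal ray with the walk is locally constant
   off the walk, vanishes far away and is odd inside the square, so a point of the
   square outside U would disconnect the complement of U.

   Conversely, suppose the complement of U has a bounded clopen piece A containing
   a.  If all loops in U were null-homotopic, the direction (z - a)/|z - a| would
   have a continuous argument on U.  Multiplying this argument by a cut-off function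
   which is 0 near A and 1 near the rest of the complement and far away, one would
   extend the direction from a large circle to a continuous map from the plane to
   the unit circle.  Such a map has a continuous argument on every disc, whereas
   the direction has none on the circle. *)
Require Import Defs.
From mathcomp Require Import all_boot all_order all_algebra.
From mathcomp Require Import all_classical all_reals all_analysis.
From mathcomp Require Import complex.
From mathcomp Require Import zify ring lra.
Set Implicit Arguments.
Unset Strict Implicit.
Unset Printing Implicit Defensive.
Import Order.TTheory GRing.Theory Num.Theory.
Import numFieldNormedType.Exports.
Local Open Scope classical_set_scope.

(** * Contracting closed lattice walks *)

(** Two obstacles shape the proof. Pushing corners must terminate, and the crossing count must be
    purely combinatorial; so walks live on pairs of natural numbers, into which a loop is brought by
    rescaling to mesh 1 in the first quadrant. Crossing parities are sums of edge functions along
    the walk, and they replace winding numbers and the Jordan curve theorem. For the converse, the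
    argument of [z - a] is built without integration: it is continued along paths through the
    arcsine of quotients of nearby unit vectors, and the assumption on loops makes the result
    independent of the path. Infinity enters only at the end: of two complementary clopen pieces in
    the sphere, one misses infinity and is therefore bounded. *)

Section LatticeWalks.
Local Notation vertex := (nat * nat)%type.
Variables (E : rel vertex) (S : vertex -> Prop).
Implicit Types (u v w x y : vertex) (p q s c : seq vertex).

Definition adjacent u v :=
  (u.1 == v.1) && ((u.2.+1 == v.2) || (v.2.+1 == u.2)) ||
  (u.2 == v.2) && ((u.1.+1 == v.1) || (v.1.+1 == u.1)).

Hypothesis E_sym : symmetric E.
Hypothesis E_adj : forall u v, E u v -> adjacent u v.
Hypothesis S_edges : forall a b, S (a, b) ->
  E (a, b) (a, b.+1) /\ E (a, b) (a.+1, b).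

(** Combinatorial homotopy with fixed ends. The two square moves are the same push, from the upper
    right corner to the lower left one, for the two directions of travel. *)
Inductive walk_equiv : seq vertex -> seq vertex -> Prop :=
| walk_equiv_refl s : walk_equiv s s
| walk_equiv_sym s t : walk_equiv s t -> walk_equiv t s
| walk_equiv_trans s t r : walk_equiv s t -> walk_equiv t r -> walk_equiv s r
| walk_equiv_stutter p x q : walk_equiv (p ++ x :: x :: q) (p ++ x :: q)
| walk_equiv_backtrack p x y q : E x y ->
    walk_equiv (p ++ x :: y :: x :: q) (p ++ x :: q)
| walk_equiv_square p a b q : S (a, b) ->
    walk_equiv (p ++ (a, b.+1) :: (a.+1, b.+1) :: (a.+1, b) :: q)
               (p ++ (a, b.+1) :: (a, b) :: (a.+1, b) :: q)
| walk_equiv_square' p a b q : S (a, b) ->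
    walk_equiv (p ++ (a.+1, b) :: (a.+1, b.+1) :: (a, b.+1) :: q)
               (p ++ (a.+1, b) :: (a, b) :: (a, b.+1) :: q).

Lemma walk_equiv_context l r s t :
  walk_equiv s t -> walk_equiv (l ++ s ++ r) (l ++ t ++ r).
Proof.
elim=> {s t} [s|s t _ IH|s t w _ IH1 _ IH2|p x q|p x y q Exy|p a b q Sab|p a b q Sab].
- exact: walk_equiv_refl.
- exact: walk_equiv_sym.
- exact: walk_equiv_trans IH1 IH2.
- by rewrite !catA -!catA !(catA l) /=; exact: walk_equiv_stutter.
- by rewrite !catA -!catA !(catA l) /=; exact: walk_equiv_backtrack.
- by rewrite !catA -!catA !(catA l) /=; exact: walk_equiv_square.
- by rewrite !catA -!catA !(catA l) /=; exact: walk_equiv_square'.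
Qed.

Definition null_cycle c :=
  if c is x :: p then walk_equiv (x :: rcons p x) [:: x] else True.

(** Moving the base point from [x] to [y] conjugates the walk by the edge between them, which a
    backtrack cancels. *)
Lemma null_cycle_rot1 c : cycle E c -> null_cycle (rot 1 c) -> null_cycle c.
Proof.
case: c => [//|x [//|y p]]; rewrite rot1_cons /= => /andP[Exy _] H.
have := walk_equiv_context [:: x] [:: x] H.
rewrite /= -!cats1 -!catA /= => H1.
apply: (walk_equiv_trans _ (walk_equiv_trans H1 (@walk_equiv_backtrack [::] x y [::] Exy))).
exact/walk_equiv_sym/(@walk_equiv_backtrack (x :: y :: p) x y [::] Exy).
Qed.

Lemma null_cycle_rot n c : cycle E c -> null_cycle (rot n c) -> null_cycle c.
Proof.
elim: n c => [|n IH] c Ec; first by rewrite rot0.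
case: (leqP (size c) n) => nc.
  by rewrite rot_oversize// ltnW.
rewrite -add1n rotD // => H.
by apply: IH => //; apply: null_cycle_rot1 => //; rewrite rot_cycle.
Qed.

(** The termination measure of [cycle_null]: pushing a corner to the lower left lowers it by 2, and
    the successor makes even the vertex [(0, 0)] count, so that deleting vertices lowers it too. *)
Definition wsize c := \sum_(u <- c) (u.1 + u.2).+1.

Lemma wsize_perm c1 c2 : perm_eq c1 c2 -> wsize c1 = wsize c2.
Proof. by move=> h; rewrite /wsize (perm_big _ h). Qed.

(** A cochain with values in Z/2, evaluated on a walk. Coboundaries vanish on closed walks by
    [xsum_telescope], which is how parities are compared. *)
Fixpoint xsum (f : vertex -> vertex -> bool) x s :=
  if s is y :: s' then f x y (+) xsum f y s' else false.

Lemma xsum_rcons f x s y :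
  xsum f x (rcons s y) = xsum f x s (+) f (last x s) y.
Proof. by elim: s x => [|z s IH] x /=; rewrite ?addbF // IH addbA. Qed.

Lemma eq_xsum_false f x s :
  (forall u v, u \in x :: s -> v \in x :: s -> f u v = false) ->
  xsum f x s = false.
Proof.
elim: s x => //= y s IH x H; rewrite H ?inE ?eqxx ?orbT // IH // => u v hu hv.
by apply: H; rewrite inE ?hu ?hv orbT.
Qed.

Lemma eq_xsum f g x s :
  (forall u v, u \in x :: s -> v \in x :: s -> E u v -> f u v = g u v) -> path E x s ->
  xsum f x s = xsum g x s.
Proof.
elim: s x => //= y s IH x H /andP[Exy pys]; rewrite H ?inE ?eqxx ?orbT // IH // => u v hu hv.
by apply: H; rewrite inE ?hu ?hv orbT.
Qed.

Lemma xsum_add f g x s :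
  xsum (fun u v => f u v (+) g u v) x s = xsum f x s (+) xsum g x s.
Proof. by elim: s x => //= y s IH x; rewrite IH addbACA. Qed.

Lemma xsum_telescope (m : vertex -> bool) x s :
  xsum (fun u v => m u (+) m v) x s = m x (+) m (last x s).
Proof.
elim: s x => [|y s IH] x /=; first by rewrite addbb.
by rewrite IH addbA -(addbA (m x)) addbb addbF.
Qed.

(** Detects the vertical edges met by the rightward ray from the centre of the square with lower
    left corner [(i, j)]. *)
Definition crossing i j u v :=
  [&& u.1 == v.1, i < u.1 &
    (u.2 == j) && (v.2 == j.+1) || (v.2 == j) && (u.2 == j.+1)].

(** The only input from topology: [odd_square_sub] supplies it for an open set whose complement does
    not split. *)
Hypothesis odd_square : forall x p i j, cycle E (x :: p) ->
  xsum (crossing i j) x (rcons p x) -> S (i, j).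

Lemma topmost_rightmost x p : exists2 v, v \in x :: p &
  forall u, u \in x :: p -> u.2 < v.2 \/ u.2 = v.2 /\ u.1 <= v.1.
Proof.
elim: p x => [|y p IH] x.
  by exists x; rewrite ?mem_head // => u; rewrite inE => /eqP ->; right.
have [v vin hv] := IH y.
have [h|h] : (x.2 < v.2 \/ x.2 = v.2 /\ x.1 <= v.1) \/
  (v.2 < x.2 \/ v.2 = x.2 /\ v.1 <= x.1) by lia.
  exists v; first by rewrite inE vin orbT.
  by move=> u; rewrite inE => /predU1P[->//|/hv].
exists x; first by rewrite mem_head.
move=> u; rewrite inE => /predU1P[->|/hv hu]; first by right.
by move: h hu; clear; case: x v u => [x1 x2] [v1 v2] [u1 u2] /=; lia.
Qed.

Lemma wsize_cons v c : wsize (v :: c) = (v.1 + v.2).+1 + wsize c.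
Proof. by rewrite /wsize big_cons. Qed.

Lemma wsize_cat c1 c2 : wsize (c1 ++ c2) = wsize c1 + wsize c2.
Proof. by rewrite /wsize big_cat. Qed.

Lemma wsize_rcons v c : wsize (rcons c v) = wsize c + (v.1 + v.2).+1.
Proof. by rewrite -cats1 wsize_cat wsize_cons /wsize big_nil addn0. Qed.

(* Pushing the topmost-rightmost corner across the square below it decreases
   the total weight of the walk, unless that corner is visited twice (split the
   walk there) or is a dead end (cut it off). *)
Lemma cycle_null c : cycle E c -> null_cycle c.
Proof.
have [n] := ubnP (wsize c); elim: n c => // n IH c cn Ec.
case: c cn Ec => [//|x0 p0] cn Ec.
have [v vin hv] := topmost_rightmost x0 p0.
have [i p rp] := rot_to vin.
apply: (@null_cycle_rot i) => //.
have {}Ec : cycle E (v :: p) by rewrite -rp rot_cycle.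
have pm : perm_eq (v :: p) (x0 :: p0) by rewrite -rp perm_rot.
have {}cn : wsize (v :: p) < n.+1 by rewrite (wsize_perm pm).
have {}hv : forall u, u \in v :: p -> u.2 < v.2 \/ u.2 = v.2 /\ u.1 <= v.1.
  by move=> u; rewrite (perm_mem pm); exact: hv.
rewrite rp; move: pm rp => _ _ {x0 p0 vin i}.
have [vp|vp] := boolP (v \in p).
  case/splitPr: vp cn Ec hv => p1 p2 cn + hv.
  rewrite /= rcons_cat rcons_cons cat_path /= => /and3P[P1 P2 P3].
  rewrite !(wsize_cons, wsize_cat) in cn.
  have N1 : null_cycle (v :: p1).
    by apply: IH; rewrite ?wsize_cons /= ?rcons_path ?P1 //; lia.
  have N2 : null_cycle (v :: p2).
    by apply: IH; rewrite ?wsize_cons /= //; lia.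
  move: N1 N2 => /= N1 N2.
  have := walk_equiv_context [::] (rcons p2 v) N1; rewrite /= cat_rcons => N3.
  exact: walk_equiv_trans N3 N2.
case: p cn Ec hv vp => [|a p] cn Ec hv vp.
  by move: Ec; rewrite /= andbT => /E_adj; rewrite /adjacent; lia.
case/lastP: p cn Ec hv vp => [|p b] cn Ec hv vp.
  move: Ec; rewrite /= => /and3P[Eva _ _].
  exact: (@walk_equiv_backtrack [::] v a [::]).
have [Eva Pab Ebv] : [/\ E v a, path E a (rcons p b) & E b v].
  by move: Ec; rewrite /= [path _ _ (rcons (rcons _ _) _)]rcons_path last_rcons => /and3P[].
have [ab|ab] := eqVneq a b.
  rewrite -{b}ab in cn Ec hv vp Pab Ebv *.
  have N1 : null_cycle (a :: p).
    by apply: IH => //; move: cn; rewrite !(wsize_cons, wsize_rcons); lia.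
  have := walk_equiv_context [:: v] [:: v] N1; rewrite /= cats1 => N2.
  apply: walk_equiv_trans N2 _.
  exact: (@walk_equiv_backtrack [::] v a [::]).
have ina : a \in v :: a :: rcons p b by rewrite !inE eqxx orbT.
have inb : b \in v :: a :: rcons p b by rewrite !inE mem_rcons mem_head !orbT.
have va : v != a by apply: contraNneq vp => ->; rewrite mem_head.
have vb : v != b by apply: contraNneq vp => ->; rewrite inE mem_rcons mem_head orbT.
have Ava := E_adj Eva; have Abv := E_adj Ebv.
have Ha := hv _ ina; have Hb := hv _ inb.
pose i := v.1.-1; pose j := v.2.-1.
(* The neighbours of a topmost and rightmost vertex are to its left and below it; being distinct,
   [a] and [b] are these two in some order. *)
have cases : v = (i.+1, j.+1) /\
  (a = (i, j.+1) /\ b = (i.+1, j) \/ a = (i.+1, j) /\ b = (i, j.+1)).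
  move: Ava Abv Ha Hb ab; rewrite {}/i {}/j /adjacent.
  case: (v) => v1 v2; case: (a) => a1 a2; case: (b) => b1 b2 /=.
  rewrite xpair_eqE !pair_equal_spec => *; lia.
have [vE abE] := cases; clearbody i j; clear cases.
have Sij : S (i, j).
  apply: (@odd_square v (a :: rcons p b)) => //.
  (* In row [j.+1], the walk meets the region right of column [i] only at [v]. So the edge from [v]
     downwards is the only one that crosses the ray, and the sum is odd. *)
  have top t : t \in a :: rcons p b -> i < t.1 -> t.2 = j.+1 -> False.
    move=> tin it tj; have tv : t != v by apply: contraNneq vp => <-.
    have : t \in v :: a :: rcons p b by rewrite inE tin orbT.
    move/hv; rewrite vE /= tj => -[|[_ ti]]; first by rewrite ltnn.
    by move: tv; rewrite vE -tj (_ : i.+1 = t.1) -?surjective_pairing ?eqxx //;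
      apply/eqP; rewrite eqn_leq it ti.
  rewrite /= xsum_rcons last_rcons eq_xsum_false; last first.
    move=> u w uin win; apply/negP => /and3P[/eqP uw iu].
    case/orP => /andP[/eqP h1 /eqP h2]; last exact: (top u).
    by apply: (top w); rewrite -?uw.
  move: abE; rewrite vE => -[] [-> ->]; rewrite /crossing /=; clear; lia.
(* With [v] rotated to the end, the push replaces this last vertex by [(i, j)]. *)
apply: (@null_cycle_rot 1) => //; rewrite rot1_cons.
have E1 : cycle E (rcons (a :: rcons p b) (i, j)).
  rewrite -rot1_cons rot_cycle /= [path _ _ (rcons (rcons _ _) _)]rcons_path Pab last_rcons /=.
  have [e1 e2] := S_edges Sij.
  by case: abE => -[-> ->]; rewrite ?e1 ?e2 // E_sym ?e1 ?e2.
have N1 : null_cycle (rcons (a :: rcons p b) (i, j)).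
  by apply: IH => //; move: cn; rewrite !(wsize_cons, wsize_rcons) vE /=; clear; lia.
move: N1 => /=; rewrite -!cats1 -!catA /= => N1.
apply: walk_equiv_trans N1.
case: abE => -[aE bE]; rewrite aE bE vE.
  exact: (@walk_equiv_square' ((i, j.+1) :: p) i j [::]).
exact: (@walk_equiv_square ((i.+1, j) :: p) i j [::]).
Qed.

End LatticeWalks.

(** * Homotopies and polygonal lines in the plane *)

Local Open Scope ring_scope.

Section Continuity.
Context {R : realType} {T : topologicalType}.
Implicit Types f g : T -> R.

Lemma cont_add f g : continuous f -> continuous g -> continuous (fun x => f x + g x).
Proof. by move=> cf cg x; apply: cvgD; [exact: cf|exact: cg]. Qed.

Lemma cont_opp f : continuous f -> continuous (fun x => - f x).
Proof. by move=> cf x; apply: cvgN; exact: cf. Qed.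

Lemma cont_mul f g : continuous f -> continuous g -> continuous (fun x => f x * g x).
Proof. by move=> cf cg x; apply: cvgM; [exact: cf|exact: cg]. Qed.

Lemma cont_max f g : continuous f -> continuous g -> continuous (fun x => Num.max (f x) (g x)).
Proof. exact: max_fun_continuous. Qed.

Lemma cont_min f g : continuous f -> continuous g -> continuous (fun x => Num.min (f x) (g x)).
Proof. exact: min_fun_continuous. Qed.

Lemma cont_pair (U V : topologicalType) (f : T -> U) (g : T -> V) :
  continuous f -> continuous g -> continuous (fun x => (f x, g x)).
Proof. by move=> cf cg x; apply: cvg_pair; [exact: cf|exact: cg]. Qed.

Lemma cont_fst (U V : topologicalType) (f : T -> U * V) :
  continuous f -> continuous (fun x => (f x).1).
Proof. by move=> cf x; apply: (cvg_comp _ _ (cf x)); exact: cvg_fst. Qed.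

Lemma cont_snd (U V : topologicalType) (f : T -> U * V) :
  continuous f -> continuous (fun x => (f x).2).
Proof. by move=> cf x; apply: (cvg_comp _ _ (cf x)); exact: cvg_snd. Qed.

Lemma cont_id : continuous (fun x : T => x).
Proof. by move=> x; exact: cvg_id. Qed.

Lemma cont_comp (U V : topologicalType) (g : U -> V) (f : T -> U) :
  continuous g -> continuous f -> continuous (fun x => g (f x)).
Proof. by move=> cg cf x; apply: continuous_comp; [exact: cf|exact: cg]. Qed.

End Continuity.

Ltac cont_step := first [
  match goal with
  | |- continuous (fun x => x) => exact: cont_id
  | |- continuous (fun _ => ?c) => exact: cst_continuous
  | |- continuous (GRing.mul ?c) => exact: (@mulrl_continuous _ c)
  | |- continuous fst => by move=> ?; exact: cvg_fst
  | |- continuous snd => by move=> ?; exact: cvg_snd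
  | |- continuous (fun x => (@?f x, @?g x)) => apply: (@cont_pair _ _ _ f g)
  | |- continuous (fun x => @?f x + @?g x) => apply: (@cont_add _ _ f g)
  | |- continuous (fun x => @?f x * @?g x) => apply: (@cont_mul _ _ f g)
  | |- continuous (fun x => - @?f x) => apply: (@cont_opp _ _ f)
  | |- continuous (fun x => Num.max (@?f x) (@?g x)) => apply: (@cont_max _ _ f g)
  | |- continuous (fun x => Num.min (@?f x) (@?g x)) => apply: (@cont_min _ _ f g)
  | |- continuous (fun x => fst (@?f x)) => apply: (@cont_fst _ _ _ f)
  | |- continuous (fun x => snd (@?f x)) => apply: (@cont_snd _ _ _ f)
  end | assumption].
Ltac cont := repeat cont_step.

Section Clamp.
Context {R : realType}.
Implicit Types t s : R.

(** The retraction of the line onto the unit interval. Composing with it replaces maps continuous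
    only within the interval or the square by globally continuous ones, so that homotopies are glued
    without subspace topologies. *)
Definition clamp t : R := Num.max 0 (Num.min 1 t).

Lemma clamp_ge0 t : 0 <= clamp t.
Proof. by rewrite /clamp le_max lexx. Qed.

Lemma clamp_le1 t : clamp t <= 1.
Proof. by rewrite /clamp ge_max ler01 ge_min lexx. Qed.

Lemma clamp_id t : 0 <= t -> t <= 1 -> clamp t = t.
Proof. by move=> t0 t1; rewrite /clamp (min_idPr t1) (max_idPr t0). Qed.

Lemma clamp_lt0 t : t <= 0 -> clamp t = 0.
Proof.
by move=> t0; rewrite /clamp (min_idPr _) ?(max_idPl _)//; apply: le_trans t0 _.
Qed.

Lemma clamp_gt1 t : 1 <= t -> clamp t = 1.
Proof. by move=> t1; rewrite /clamp (min_idPl t1) (max_idPr _). Qed.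

Lemma cont_clamp (T : topologicalType) (f : T -> R) :
  continuous f -> continuous (fun x => clamp (f x)).
Proof. by move=> cf; rewrite /clamp; cont. Qed.

Lemma clamp_in t : `[0, 1]%classic (clamp t).
Proof. by rewrite /= in_itv /= clamp_ge0 clamp_le1. Qed.

Lemma clamp_idem t : clamp (clamp t) = clamp t.
Proof. by rewrite clamp_id ?clamp_ge0 ?clamp_le1. Qed.

End Clamp.

Lemma within_retract (T U V : topologicalType) (A : set U) (f : U -> V) (r : T -> U) :
  continuous r -> (forall x, A (r x)) -> {within A, continuous f} ->
  continuous (fun x => f (r x)).
Proof.
move=> cr Ar /subspace_continuousP cf x W nW.
have := cr x (fun u => A u -> W (f u)) (cf _ (Ar x) W nW).
rewrite nbhs_simpl /= => H.
by apply: filterS H => y; apply.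
Qed.

Ltac cont_step2 := first [ cont_step | match goal with
  | |- continuous (fun x => clamp (@?f x)) => apply: (@cont_clamp _ _ f) end ].
Ltac contc := repeat cont_step2.

Section Plane.
Context {R : realType}.
Local Notation P := (R * R)%type.
Implicit Types (U : set P) (x y z : P) (f g : R -> P).

Definition lerp (t : R) x y : P :=
  ((1 - t) * x.1 + t * y.1, (1 - t) * x.2 + t * y.2).

Lemma lerp0 x y : lerp 0 x y = x.
Proof. by rewrite /lerp subr0 !mul1r !mul0r !addr0 -surjective_pairing. Qed.

Lemma lerp1 x y : lerp 1 x y = y.
Proof. by rewrite /lerp subrr !mul1r !mul0r !add0r -surjective_pairing. Qed.

Lemma lerpxx t x : lerp t x x = x.
Proof. by rewrite /lerp -!mulrDl subrK !mul1r -surjective_pairing. Qed.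

Lemma cont_lerp (T : topologicalType) (s : T -> R) (f g : T -> P) :
  continuous s -> continuous f -> continuous g ->
  continuous (fun w => lerp (s w) (f w) (g w)).
Proof. by move=> cs cf cg; rewrite /lerp; cont. Qed.

Lemma lerp_itv (a b x y t : R) : 0 <= t <= 1 -> a <= x <= b -> a <= y <= b ->
  a <= (1 - t) * x + t * y <= b.
Proof. move=> *; nra. Qed.

Definition homotopic U f g := exists H : R * R -> P, [/\ continuous H,
  forall t s : R, 0 <= t <= 1 -> 0 <= s <= 1 -> U (H (t, s)),
  forall t : R, 0 <= t <= 1 -> H (t, 0) = f t /\ H (t, 1) = g t &
  forall s : R, 0 <= s <= 1 -> H (0, s) = f 0 /\ H (1, s) = f 1].

Lemma homotopic_ends U f g : homotopic U f g -> g 0 = f 0 /\ g 1 = f 1.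
Proof.
move=> [H [_ _ H1 H2]]; have [a b] := H2 1 (introT andP (conj ler01 (lexx _))).
rewrite -(H1 0 _).2 ?lexx ?ler01 // -(H1 1 _).2 ?lexx ?ler01 //.
Qed.

Lemma homotopic_sym U f g : homotopic U f g -> homotopic U g f.
Proof.
move=> /[dup] /homotopic_ends [e0 e1] [H [cH UH H1 H2]].
exists (fun p => H (p.1, 1 - p.2)); split => /=.
- by apply: (cont_comp cH); cont.
- by move=> t s t01 s01; apply: UH => //; lra.
- by move=> t t01; rewrite subr0 subrr; have [-> ->] := H1 t t01.
- by move=> s s01; rewrite e0 e1; apply: H2; lra.
Qed.

(* The two homotopies are glued by the additive formula
   [H1 (t, 2s) + H2 (t, 2s - 1) - g t], whose continuity is immediate. *)
Lemma homotopic_trans U f g h : continuous g ->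
  homotopic U f g -> homotopic U g h -> homotopic U f h.
Proof.
move=> cg /[dup] /homotopic_ends [e0 e1] [H [cH UH H1 H2]] [K [cK UK K1 K2]].
pose a (p : R * R) := H (p.1, clamp (2 * p.2)).
pose b (p : R * R) := K (p.1, clamp (2 * p.2 - 1)).
have ca : continuous a by apply: (cont_comp cH); contc.
have cb : continuous b by apply: (cont_comp cK); contc.
have cg' : continuous (fun p : R * R => g p.1) by apply: (cont_comp cg); contc.
pose M (p : R * R) : P := ((a p).1 + (b p).1 - (g p.1).1, (a p).2 + (b p).2 - (g p.1).2).
have ME (t s : R) : 0 <= t <= 1 -> M (t, s) = if s <= 1 / 2 then a (t, s) else b (t, s).
  move=> t01; rewrite /M /=; case: ifPn => hs.
    have -> : b (t, s) = g t.
      by rewrite /b /= clamp_lt0 ?(K1 t t01).1 //; lra.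
    by rewrite !addrK -surjective_pairing.
  have -> : a (t, s) = g t.
    by rewrite /a /= clamp_gt1 ?(H1 t t01).2 //; lra.
  by rewrite ![(g t).1 + _]addrC ![(g t).2 + _]addrC !addrK -surjective_pairing.
have c01 (u : R) : 0 <= clamp u <= 1 by rewrite clamp_ge0 clamp_le1.
exists M; split.
- by rewrite /M; cont.
- move=> t s t01 s01; rewrite ME //; case: ifP => _; first exact: UH.
  exact: UK.
- move=> t t01; rewrite !ME // ifT; last by lra.
  rewrite ifF; last by apply/negbTE; rewrite -ltNge; lra.
  rewrite /a /b /= mulr0 mulr1 clamp_lt0 // clamp_gt1; last by lra.
  by rewrite (H1 t t01).1 (K1 t t01).2.
- move=> s s01; rewrite !ME ?lexx ?ler01 // /a /b /=.
  have [-> ->] := H2 _ (c01 (2 * s)); have [-> ->] := K2 _ (c01 (2 * s - 1)).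
  by rewrite e0 e1; case: ifP.
Qed.

Lemma homotopic_lerp U f g : continuous f -> continuous g ->
  f 0 = g 0 -> f 1 = g 1 ->
  (forall t s : R, 0 <= t <= 1 -> 0 <= s <= 1 -> U (lerp s (f t) (g t))) ->
  homotopic U f g.
Proof.
move=> cf cg e0 e1 H; exists (fun p => lerp p.2 (f p.1) (g p.1)); split => //=.
- by apply: cont_lerp; cont; [apply: (cont_comp cf)|apply: (cont_comp cg)]; cont.
- by move=> t t01; rewrite lerp0 lerp1.
- by move=> s _; rewrite e0 e1 !lerpxx.
Qed.

(* The polygonal line through the points of [x :: s], reached at the integer
   times [0, 1, ...] and stationary before and after.  The line through [s] is
   delayed by one; as it waits at [y] for [t <= 1], the corrective term is what
   is left to travel from [x] to [y]. *)
Fixpoint poly x (s : seq P) (t : R) : P :=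
  if s is y :: s' then
    let z := poly y s' (t - 1) in
    (z.1 + (clamp t - 1) * (y.1 - x.1), z.2 + (clamp t - 1) * (y.2 - x.2))
  else x.

Lemma cont_poly x s : continuous (poly x s).
Proof.
elim: s x => [|y s IH] x /=; first exact: cst_continuous.
have c : continuous (fun t : R => poly y s (t - 1)) by apply: (cont_comp (IH y)); cont.
by cont; apply: cont_clamp; cont.
Qed.

Lemma poly_le0 x s t : t <= 0 -> poly x s t = x.
Proof.
elim: s x t => [//|y s IH] x t t0 /=; rewrite IH ?clamp_lt0 //; last by lra.
by rewrite (surjective_pairing x) /=; congr pair; ring.
Qed.

Lemma poly_ge1 x y s t : 1 <= t -> poly x (y :: s) t = poly y s (t - 1).
Proof. by move=> t1; rewrite /= clamp_gt1 // subrr !mul0r !addr0 -surjective_pairing. Qed.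

Lemma poly_le1 x y s t : 0 <= t <= 1 -> poly x (y :: s) t = lerp t x y.
Proof.
move=> /andP[t0 t1]; rewrite /= clamp_id // poly_le0 /lerp; last by lra.
by congr pair; ring.
Qed.

Lemma poly_cat_ge x p s t : (size p)%:R <= t ->
  poly x (p ++ s) t = poly (last x p) s (t - (size p)%:R).
Proof.
elim: p x t => [|y p IH] x t; first by rewrite subr0.
rewrite [size _]/= -add1n natrD => h.
have p0 : 0 <= (size p)%:R :> R by [].
rewrite cat_cons poly_ge1; last by lra.
by rewrite IH; [rewrite /= opprD addrA|lra].
Qed.

Lemma poly_cat_le x p s t : t <= (size p)%:R -> poly x (p ++ s) t = poly x p t.
Proof.
elim: p x t => [|y p IH] x t; first by move=> /poly_le0 ->.
rewrite [size _]/= -add1n natrD => h.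
by rewrite /= IH //; lra.
Qed.

Lemma poly_ge x s t : (size s)%:R <= t -> poly x s t = last x s.
Proof. by move=> h; rewrite -{1}[s]cats0 poly_cat_ge. Qed.

Definition segU U x y := forall t : R, 0 <= t <= 1 -> U (lerp t x y).

Fixpoint pathU U x s := if s is y :: s' then segU U x y /\ pathU U y s' else U x.

Lemma segU_ends U x y : segU U x y -> U x /\ U y.
Proof.
by move=> H; split; [rewrite -(lerp0 x y)|rewrite -(lerp1 x y)]; apply: H; rewrite lexx ler01.
Qed.

Lemma pathU_cat U x p s : pathU U x (p ++ s) <-> pathU U x p /\ pathU U (last x p) s.
Proof.
elim: p x => [|y p IH] x /=.
  split=> [h|[]//]; split=> //.
  by case: s h => //= y s [hs _]; case: (segU_ends hs).
by rewrite IH; tauto.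
Qed.

Lemma pathU_poly U x s t : pathU U x s -> U (poly x s t).
Proof.
elim: s x t => [//|y s IH] x t [h1 h2].
have [t0|t0] := leP t 0; first by rewrite poly_le0 //; case: (segU_ends h1).
have [t1|t1] := leP t 1; first by rewrite poly_le1 ?(ltW t0) //; apply: h1; rewrite ltW.
by rewrite poly_ge1 ?ltW //; apply: IH.
Qed.

Definition polyline x s (t : R) := poly x s ((size s)%:R * t).

Lemma cont_polyline x s : continuous (polyline x s).
Proof. by apply: (cont_comp (@cont_poly x s)); cont. Qed.

Lemma polyline0 x s : polyline x s 0 = x.
Proof. by rewrite /polyline mulr0 poly_le0. Qed.

Lemma polyline1 x s : polyline x s 1 = last x s.
Proof. by rewrite /polyline mulr1 poly_ge. Qed.

(** Both lines have the same number of vertices, so at each time their straight-line homotopy rests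
    on the common part or stays in a triangle spanned by [y], [y'] and a neighbouring vertex. *)
Lemma homotopic_vertex_move U x p y y' z q :
  pathU U x (p ++ y :: z :: q) ->
  (forall t s : R, 0 <= t <= 1 -> 0 <= s <= 1 -> U (lerp t (last x p) (lerp s y y'))) ->
  (forall t s : R, 0 <= t <= 1 -> 0 <= s <= 1 -> U (lerp t (lerp s y y') z)) ->
  homotopic U (polyline x (p ++ y :: z :: q)) (polyline x (p ++ y' :: z :: q)).
Proof.
move=> pU h1 h2; apply: homotopic_lerp => //.
- exact: cont_polyline.
- exact: cont_polyline.
- by rewrite !polyline0.
- by rewrite !polyline1 !last_cat.
move=> t s t01 s01; have := pathU_poly ((size (p ++ y :: z :: q))%:R * t) pU.
rewrite /polyline !size_cat /=; set u := _ * t => Uu.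
have lerpE (a b c : P) (r : R) : lerp s (lerp r a b) (lerp r a c) = lerp r a (lerp s b c).
  by rewrite /lerp /=; congr pair; ring.
have lerpE' (a b c : P) (r : R) : lerp s (lerp r b a) (lerp r c a) = lerp r (lerp s b c) a.
  by rewrite /lerp /=; congr pair; ring.
have [up|up] := leP u (size p)%:R.
  by move: Uu; rewrite !(poly_cat_le _ _ up) lerpxx.
move: Uu; rewrite !poly_cat_ge ?ltW //.
have [up1|up1] := leP (u - (size p)%:R) 1.
  by rewrite !poly_le1 ?lerpE; try lra; move=> _; apply: h1 => //; lra.
rewrite !(@poly_ge1 (last x p)) ?ltW //.
have [up2|up2] := leP (u - (size p)%:R - 1) 1.
  by rewrite !poly_le1 ?lerpE'; try lra; move=> _; apply: h2 => //; lra.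
by rewrite !poly_ge1 ?ltW // lerpxx.
Qed.

(** The numbers of segments differ, so vertices cannot be matched. One line is instead a
    reparametrisation of the other, and interpolating the parameters stays on its trace. *)
Lemma homotopic_stutter U x p q : pathU U x (p ++ q) ->
  homotopic U (polyline x (p ++ last x p :: q)) (polyline x (p ++ q)).
Proof.
move=> pU; apply: homotopic_sym.
set k : R := (size p)%:R; set m : R := (size (p ++ q))%:R.
have k0 : 0 <= k by []. have km : k <= m by rewrite ler_nat size_cat leq_addr.
(* [psi] runs up to [k], halts for one unit of time and goes on one unit late. *)
pose psi (u : R) := Num.min u (Num.max k (u - 1)).
have psiE u : poly x (p ++ last x p :: q) u = poly x (p ++ q) (psi u).
  rewrite /psi; have [uk|uk] := leP u k.
    rewrite (min_idPl _) ?le_max ?uk // !(poly_cat_le _ _) //.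
  have [uk1|uk1] := leP (u - 1) k.
    rewrite (min_idPr (ltW uk)) (poly_cat_ge _ _ (ltW uk)) poly_cat_ge // poly_le1.
      by rewrite subrr poly_le0 // lerpxx.
    by lra.
  rewrite (min_idPr _); last by lra.
  rewrite (poly_cat_ge _ _ (ltW uk)) (poly_cat_ge _ _ (ltW uk1)) poly_ge1; last by rewrite -/k; lra.
  by congr poly; rewrite -/k; ring.
exists (fun p' => poly x (p ++ q) ((1 - p'.2) * (m * p'.1) + p'.2 * psi ((m + 1) * p'.1))).
split => /=.
- apply: (cont_comp (@cont_poly x (p ++ q))); rewrite /psi; cont.
- by move=> t s _ _; apply: pathU_poly.
- move=> t t01; rewrite subr0 !mul1r mul0r addr0 subrr !mul0r add0r.
  rewrite /polyline psiE; split=> //; congr (poly _ _ (psi (_ * _))).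
  by rewrite /m !size_cat /= addnS -natr1.
- move=> s s01; rewrite polyline0 polyline1 !mulr0 !mulr1; split.
    by rewrite poly_le0 // add0r mulr_ge0_le0 //; [lra|rewrite /psi ge_min lexx].
  rewrite poly_ge // (_ : psi (m + 1) = m); first by rewrite -/m; lra.
  by rewrite /psi addrK (max_idPr km) (min_idPr _) //; lra.
Qed.

End Plane.

(** * Lattice walks as polygonal lines *)

Section PlaneSets.
Context {R : realType}.
Local Notation P := (R * R)%type.
Implicit Types (U A B : set P) (z : P).

Definition in_box (e : R) z w := `|w.1 - z.1| < e /\ `|w.2 - z.2| < e.

Lemma nbhs_box z (V : set P) :
  nbhs z V <-> exists2 e : R, 0 < e & forall w, in_box e z w -> V w.
Proof.
split=> [/nbhs_ballP [e /= e0 H]|[e e0 H]].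
  exists e => // w [h1 h2]; apply: H.
  by split; rewrite /ball /= distrC.
apply/nbhs_ballP; exists e => // w [h1 h2]; apply: H.
by split; rewrite distrC; [exact: h1|exact: h2].
Qed.

Definition bounded_box A := exists M : R, forall z, A z -> `|z.1| <= M /\ `|z.2| <= M.

(** [A] is the part that stays away from infinity; [B] may be empty, since the point at infinity
    belongs to its side. *)
Definition splits U A B :=
  [/\ closed A, closed B, A `&` B = set0, A `|` B = ~` U & bounded_box A /\ A !=set0].

Lemma closed_box A : (forall z, ~ A z -> exists2 e : R, 0 < e & forall w, in_box e z w -> ~ A w) ->
  closed A.
Proof.
move=> H; rewrite -[A]setCK; apply: open_closedC.
by rewrite openE => z /H /nbhs_box.
Qed.

End PlaneSets.

Section Grid.
Context {R : realType}.
Local Notation P := (R * R)%type.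
Local Notation vertex := (nat * nat)%type.
Implicit Types (U A B : set P) (z : P) (u v : vertex).

Definition emb u : P := (u.1%:R, u.2%:R).

(** For adjacent vertices this bounding rectangle degenerates to the segment between them. *)
Definition onseg u v z :=
  (u.1%:R <= z.1 <= v.1%:R \/ v.1%:R <= z.1 <= u.1%:R) /\
  (u.2%:R <= z.2 <= v.2%:R \/ v.2%:R <= z.2 <= u.2%:R).

Definition edge U u v := adjacent u v && `[< forall z, onseg u v z -> U z >].

Definition square U u := forall z,
  u.1%:R <= z.1 <= u.1%:R + 1 -> u.2%:R <= z.2 <= u.2%:R + 1 -> U z.

Lemma edge_sym U : symmetric (edge U).
Proof.
suff H u v : edge U u v -> edge U v u by move=> u v; apply/idP/idP; apply: H.
move=> /andP[a /asboolP h]; apply/andP; split.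
  by move: a; rewrite /adjacent; lia.
by apply/asboolP => z [h1 h2]; apply: h; split; tauto.
Qed.

Lemma edge_adjacent U u v : edge U u v -> adjacent u v.
Proof. by case/andP. Qed.

Lemma edge_onseg U u v z : edge U u v -> onseg u v z -> U z.
Proof. by case/andP => _ /asboolP; apply. Qed.

Lemma edge_segU U u v : edge U u v -> segU U (emb u) (emb v).
Proof.
move=> Euv t t01; apply: (edge_onseg Euv); split => /=.
  by have [h|h] := leP (u.1%:R : R) v.1%:R; [left|right]; apply: lerp_itv; lra.
by have [h|h] := leP (u.2%:R : R) v.2%:R; [left|right]; apply: lerp_itv; lra.
Qed.

Lemma square_edge U a b : square U (a, b) ->
  edge U (a, b) (a, b.+1) /\ edge U (a, b) (a.+1, b).
Proof.
rewrite /square /edge /onseg /adjacent /= => H; rewrite -!natr1; split.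
  apply/andP; split; first by lia.
  by apply/asboolP => z [h1 h2]; apply: H; lra.
apply/andP; split; first by lia.
by apply/asboolP => z [h1 h2]; apply: H; lra.
Qed.

Definition walk_line x s : R -> P := polyline (emb x) (map emb s).

(** Containment in [U] is transferred both ways because the induction on [walk_equiv] includes
    symmetry. *)
Definition walk_sound U (w1 w2 : seq vertex) :=
  match w1, w2 with
  | [::], [::] => True
  | x :: s, y :: t => [/\ x = y,
     pathU U (emb x) (map emb s) <-> pathU U (emb y) (map emb t) &
     pathU U (emb x) (map emb s) -> homotopic U (walk_line x s) (walk_line y t)]
  | _, _ => False
  end.

Lemma walk_sound_sym U w1 w2 : walk_sound U w1 w2 -> walk_sound U w2 w1.
Proof.
case: w1 w2 => [|x s] [|y t] //= [-> e h]; split => //; first exact: iff_sym.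
by move=> /(iffRL e) /h; exact: homotopic_sym.
Qed.

Lemma walk_sound_trans U w1 w2 w3 :
  walk_sound U w1 w2 -> walk_sound U w2 w3 -> walk_sound U w1 w3.
Proof.
case: w1 w2 w3 => [|x s] [|y t] [|z r] //= [-> e h] [<- e' h']; split => //.
  exact: iff_trans e e'.
move=> p; apply: (homotopic_trans (@cont_polyline _ _ _) (h p)).
exact/h'/(iffLR e).
Qed.

Lemma homotopic_refl U (f : R -> P) : continuous f ->
  (forall t : R, 0 <= t <= 1 -> U (f t)) -> homotopic U f f.
Proof. by move=> cf Uf; apply: homotopic_lerp => // t s t01 _; rewrite lerpxx; apply: Uf. Qed.

Lemma walk_sound_refl U w : walk_sound U w w.
Proof.
case: w => //= x s; split => // p; apply: homotopic_refl.
  exact: cont_polyline.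
by move=> t _; apply: pathU_poly.
Qed.

(** [polyline] takes its first vertex apart. As [x0] and [p'] do not depend on [t], two walks with a
    common beginning are rewritten alike. *)
Lemma rehead (p : seq vertex) x : exists x0 p',
  last x0 p' = x /\ forall t, p ++ x :: t = x0 :: p' ++ t.
Proof.
case: p => [|a p]; first by exists x, [::].
by exists a, (rcons p x); rewrite last_rcons; split => // t; rewrite cat_rcons.
Qed.

Lemma walk_sound_stutter U p x q : walk_sound U (p ++ x :: x :: q) (p ++ x :: q).
Proof.
have [x0 [p' [px E]]] := rehead p x; rewrite !E /=.
have pE : last (emb x0) (map emb p') = emb x by rewrite last_map px.
have e : pathU U (emb x0) (map emb (p' ++ x :: q)) <-> pathU U (emb x0) (map emb (p' ++ q)).
  rewrite !map_cat !pathU_cat pE /=.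
  split=> [[h1 [h2 h3]] //|[h1 h2]]; split => //; split => // t _.
  by rewrite lerpxx; move: h2; rewrite -[map _ q]cat0s => /pathU_cat[].
split=> // /(iffLR e) h; rewrite /walk_line !map_cat /= -pE; apply: homotopic_stutter.
by rewrite -map_cat.
Qed.

Lemma walk_sound_move U p x y y' v q :
  (forall t s : R, 0 <= t <= 1 -> 0 <= s <= 1 -> U (lerp t (emb x) (lerp s (emb y) (emb y')))) ->
  (forall t s : R, 0 <= t <= 1 -> 0 <= s <= 1 -> U (lerp t (lerp s (emb y) (emb y')) (emb v))) ->
  walk_sound U (p ++ x :: y :: v :: q) (p ++ x :: y' :: v :: q).
Proof.
move=> h1 h2; have [x0 [p' [px E]]] := rehead p x; rewrite !E /=.
have pE : last (emb x0) (map emb p') = emb x by rewrite last_map px.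
have i0 : 0 <= (0 : R) <= 1 by rewrite lexx ler01.
have i1 : 0 <= (1 : R) <= 1 by rewrite lexx ler01.
split=> //.
  rewrite !map_cat !pathU_cat pE /=; split=> -[k1 [k2 [k3 k4]]]; do ![split=> //] => t t01.
  - by have := h1 t 1 t01 i1; rewrite lerp1.
  - by have := h2 t 1 t01 i1; rewrite lerp1.
  - by have := h1 t 0 t01 i0; rewrite lerp0.
  - by have := h2 t 0 t01 i0; rewrite lerp0.
rewrite /walk_line !map_cat /= => h; apply: homotopic_vertex_move => //.
by rewrite pE.
Qed.

Lemma walk_equiv_sound U w1 w2 :
  walk_equiv (edge U) (square U) w1 w2 -> walk_sound U w1 w2.
Proof.
elim=> {w1 w2} [w|w1 w2 _|w1 w2 w3 _ h1 _ h2|p x q|p x y q Exy|p a b q Sab|p a b q Sab].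
- exact: walk_sound_refl.
- exact: walk_sound_sym.
- exact: walk_sound_trans h1 h2.
- exact: walk_sound_stutter.
(* The backtrack [x y x] is first slid along the edge to [x x x], from which two stutters are
   removed. *)
- apply: walk_sound_trans (walk_sound_stutter _ _ _ _).
  apply: walk_sound_trans (walk_sound_stutter _ _ _ _).
  have seg := edge_segU Exy.
  apply: walk_sound_move => t s t01 s01.
    rewrite (_ : lerp _ _ _ = lerp (t * (1 - s)) (emb x) (emb y)).
      by apply: seg; nra.
    by rewrite /lerp /=; congr pair; ring.
  rewrite (_ : lerp _ _ _ = lerp ((1 - t) * (1 - s)) (emb x) (emb y)).
    by apply: seg; nra.
  by rewrite /lerp /=; congr pair; ring.
- apply: walk_sound_move => t s t01 s01; apply: Sab; rewrite /= -?natr1;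
    do ![apply: lerp_itv => //]; lra.
- apply: walk_sound_move => t s t01 s01; apply: Sab; rewrite /= -?natr1;
    do ![apply: lerp_itv => //]; lra.
Qed.

(** Rows are half-open: of two vertical edges stacked at a vertex that lies on the ray, only the
    upper one counts. *)
Definition ray_crossing z u v :=
  [&& u.1 == v.1, z.1 < u.1%:R &
    (u.2%:R <= z.2 < v.2%:R) || (v.2%:R <= z.2 < u.2%:R)].

Lemma edge_cases U u v : edge U u v ->
  [\/ v = (u.1, u.2.+1), u = (v.1, v.2.+1), v = (u.1.+1, u.2) | u = (v.1.+1, v.2)].
Proof.
case: u v => [u1 u2] [v1 v2] /edge_adjacent; rewrite /adjacent /=.
case/orP => /andP[/eqP-> /orP[/eqP<-|/eqP<-]].
- exact: Or41. - exact: Or42. - exact: Or43. - exact: Or44.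
Qed.

(** The coordinates of a point may themselves be integers, so only the lattice coordinates different
    from them can be kept at distance [e]. *)
Lemma lattice_gap (c : R) (s : seq nat) : exists2 e : R, 0 < e <= 1 / 2 &
  forall n, n \in s -> n%:R != c -> n%:R + e <= c \/ c + e <= n%:R.
Proof.
elim: s => [|n s [e e0 IH]]; first by exists (1 / 2) => //; lra.
have [nc|nc] := eqVneq n%:R c.
  by exists e => // m; rewrite inE => /predU1P[->|/IH//]; rewrite nc eqxx.
exists (Num.min e `|n%:R - c|).
  by rewrite lt_min ge_min normr_gt0 subr_eq0 nc; case/andP: e0 => -> ->.
move=> m; rewrite inE => /predU1P[-> _|ms mc].
  have h1 : Num.min e `|n%:R - c| <= `|n%:R - c| by rewrite ge_min lexx orbT.
  have [h|h] := leP 0 (n%:R - c).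
    by move: h1; rewrite {2}(ger0_norm h) => h1; right; lra.
  by move: h1; rewrite {2}(ltr0_norm h) => h1; left; lra.
have h1 : Num.min e `|n%:R - c| <= e by rewrite ge_min lexx.
by case: (IH m ms mc) => h; [left|right]; lra.
Qed.

End Grid.

(** * Parity of ray crossings *)

Section Parity.
Context {R : realType}.
Local Notation P := (R * R)%type.
Local Notation vertex := (nat * nat)%type.
Implicit Types (U A B : set P) (z : P) (u v : vertex).

Definition gap (e c y : R) := c != y -> c + e <= y \/ y + e <= c.

(** As rows are half-open, a small move changes the row only when it goes down from an integer
    height; then the rows just above and just below that height both switch. *)
Lemma row_switch (b e y y' : R) : 0 < e <= 1 / 2 -> y - e < y' < y + e ->
  gap e b y -> gap e (b + 1) y ->
  (b <= y' < b + 1) (+) (b <= y < b + 1) =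
  (y' < y) && ((b == y) (+) (b + 1 == y)).
Proof.
move=> /andP[e0 e1] /andP[y1 y2] Gb Gb1.
have [b0|/Gb {}Gb] := eqVneq b y.
  have -> : (b + 1 == y) = false by apply/negbTE/eqP; lra.
  have -> : y < b + 1 by lra.
  have -> : y' < b + 1 by lra.
  by rewrite b0 lexx !andbT /= addbT ltNge.
have [b1|/Gb1 {}Gb1] := eqVneq (b + 1) y.
  have -> : b <= y' by lra.
  have -> : (y < b + 1) = false by apply/negbTE; rewrite -leNgt; lra.
  by rewrite !andbF /= addbF andbT b1.
rewrite andbF; case: Gb => Gb.
  have -> : b <= y' by lra.
  have -> : b <= y by lra.
  case: Gb1 => Gb1 /=.
    have -> : (y' < b + 1) = false by apply/negbTE; rewrite -leNgt; lra.
    by have -> : (y < b + 1) = false by apply/negbTE; rewrite -leNgt; lra.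
  have -> : y' < b + 1 by lra.
  by have -> : y < b + 1 by lra.
have -> : (b <= y') = false by apply/negbTE; rewrite -ltNge; lra.
by have -> : (b <= y) = false by apply/negbTE; rewrite -ltNge; lra.
Qed.

Lemma row_outside (b e y y' : R) : 0 < e <= 1 / 2 -> y - e < y' < y + e ->
  gap e b y -> gap e (b + 1) y -> ~ (b <= y <= b + 1) -> (b <= y' < b + 1) = false.
Proof.
move=> /andP[e0 e1] /andP[y1 y2] Gb Gb1 ny; apply/negbTE/negP => /andP[h1 h2].
have [b0|/Gb {}Gb] := eqVneq b y; first by apply: ny; lra.
have [b1|/Gb1 {}Gb1] := eqVneq (b + 1) y; first by apply: ny; lra.
by case: Gb => Gb; last lra; case: Gb1 => Gb1; first lra; apply: ny; lra.
Qed.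

Lemma column_stable (a e x x' : R) : x - e < x' < x + e -> gap e a x -> a != x ->
  (x' < a) = (x < a).
Proof.
move=> /andP[x1 x2] G ax; case: (G ax) => h.
  by apply/idP/idP => ?; lra.
have -> : x' < a by lra.
by have -> : x < a by lra.
Qed.

(* Moving [z] to [w] changes the crossing of the rightward ray with a single
   edge by a coboundary: below the height of [z], the vertices on the ray from
   [z] switch sides. *)
Lemma ray_crossing_move U (e : R) z w u v : 0 < e <= 1 / 2 ->
  edge U u v -> ~ U z -> in_box e z w ->
  (forall n, n \in [:: u.1; v.1] -> gap e n%:R z.1) ->
  (forall n, n \in [:: u.2; v.2] -> gap e n%:R z.2) ->
  let m (t : vertex) := [&& w.2 < z.2, z.1 < t.1%:R & t.2%:R == z.2] in
  ray_crossing w u v (+) ray_crossing z u v = m u (+) m v.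
Proof.
move=> e01 Euv nUz [zw1 zw2] G1 G2.
have nseg : ~ onseg u v z by move=> /(edge_onseg Euv).
rewrite !ltr_distl in zw1 zw2.
have F (b : nat) (c : R) : (b%:R + 1 <= c < b%:R) = false.
  by clear; apply/negbTE/negP => /andP[? ?]; lra.
have horizontal a b : ~ onseg (a, b) (a.+1, b) z ->
    (z.1 < a%:R) && (b%:R == z.2) = (z.1 < a.+1%:R) && (b%:R == z.2).
  rewrite /onseg /= -natr1 => ns.
  have [bz|bz] := eqVneq (b%:R) z.2; last by rewrite !andbF.
  rewrite !andbT; apply/idP/idP => h; first by clear - h; lra.
  rewrite ltNge; apply/negP => h'; apply: ns; rewrite bz; clear - h h'; split; left; lra.
have vertical a b : gap e a%:R z.1 -> gap e b%:R z.2 -> gap e b.+1%:R z.2 ->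
    ~ onseg (a, b) (a, b.+1) z ->
    (w.1 < a%:R) && (b%:R <= w.2 < b%:R + 1) (+) (z.1 < a%:R) && (b%:R <= z.2 < b%:R + 1) =
    [&& w.2 < z.2, z.1 < a%:R & b%:R == z.2] (+)
    [&& w.2 < z.2, z.1 < a%:R & b%:R + 1 == z.2].
  rewrite /onseg /= -natr1 => {}G1 Gb Gb1 ns.
  have [az|az] := eqVneq (a%:R) z.1.
    rewrite az ltxx !andbF (row_outside e01 zw2 Gb Gb1) ?andbF // => h.
    by apply: ns; rewrite az lexx; split; left.
  rewrite (column_stable zw1 G1 az); have [za|za] := ltP z.1 a%:R; last by rewrite !andbF.
  by rewrite /= (row_switch e01 zw2 Gb Gb1) -andb_addr.
rewrite /ray_crossing.
case: (edge_cases Euv) nseg G1 G2;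
    [case: u {Euv} => a b|case: v {Euv} => a b|case: u {Euv} => a b|case: v {Euv} => a b]
    => /= -> /= nseg G1 G2.
- have key := vertical a b (G1 _ (mem_head _ _)) (G2 _ (mem_head _ _))
    (G2 b.+1 (mem_last _ [:: _])) nseg.
  rewrite eqxx /= -!natr1.
  by rewrite !F !orbF.
- have key := vertical a b.
  rewrite eqxx /= -!natr1.
  rewrite !F /= [RHS]addbC; apply: key => //.
  - exact: G1 (mem_head _ _).
  - exact: G2 (mem_last _ [:: _]).
  - exact: G2 (mem_head _ _).
  by move: nseg; rewrite /onseg /=; tauto.
- have -> : a == a.+1 = false by lia.
  by rewrite /= (horizontal _ _ nseg) addbb.
- have -> : a.+1 == a = false by lia.
  rewrite /= (horizontal a b) ?addbb //.
  by move: nseg; rewrite /onseg /=; tauto.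
Qed.

Definition parity z x s := xsum (ray_crossing z) x s.

(** By [ray_crossing_move] the change is a coboundary, and coboundaries cancel along a closed
    walk. *)
Lemma parity_locally_constant U x s z : path (edge U) x s -> last x s = x -> ~ U z ->
  exists2 e : R, 0 < e & forall w, in_box e z w -> parity w x s = parity z x s.
Proof.
move=> p lx nUz.
have [e1 e10 G1] := lattice_gap z.1 (map fst (x :: s)).
have [e2 e20 G2] := lattice_gap z.2 (map snd (x :: s)).
pose e := Num.min e1 e2.
have ee1 : e <= e1 by rewrite ge_min lexx.
have ee2 : e <= e2 by rewrite ge_min lexx orbT.
have e0 : 0 < e by rewrite lt_min; lra.
exists e => // w zw.
suff : parity w x s (+) parity z x s = false by do 2 case: (parity _ x s).
rewrite -xsum_add.
pose m (t : vertex) := [&& w.2 < z.2, z.1 < t.1%:R & t.2%:R == z.2].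
rewrite (@eq_xsum (edge U) _ (fun u v => m u (+) m v)) ?xsum_telescope ?lx ?addbb //.
move=> u v us vs Euv; apply: (@ray_crossing_move U e) => //; first by lra.
- move=> n; rewrite !inE => /orP[]/eqP-> h.
    by case: (G1 u.1 (map_f _ us) h); [left|right]; lra.
  by case: (G1 v.1 (map_f _ vs) h); [left|right]; lra.
- move=> n; rewrite !inE => /orP[]/eqP-> h.
    by case: (G2 u.2 (map_f _ us) h); [left|right]; lra.
  by case: (G2 v.2 (map_f _ vs) h); [left|right]; lra.
Qed.

Lemma parity_bounded U x s : path (edge U) x s -> last x s = x ->
  bounded_box [set z : P | parity z x s].
Proof.
move=> p lx.
have [M HM] : exists M : nat, forall u, u \in x :: s -> (u.1 <= M)%N /\ (u.2 <= M)%N.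
  elim: (x :: s) => [|v t [M IH]]; first by exists 0%N.
  exists (maxn M (maxn v.1 v.2)) => u; rewrite inE => /predU1P[->|/IH]; lia.
exists M%:R => z /= hz.
have HM' u : u \in x :: s -> u.1%:R <= M%:R :> R /\ u.2%:R <= M%:R :> R.
  by move=> /HM[]; rewrite !ler_nat.
have n0 (n : nat) : 0 <= n%:R :> R by [].
suff : [&& 0 <= z.1, z.1 <= M%:R, 0 <= z.2 & z.2 <= M%:R].
  by move=> /and4P[? ? ? ?]; rewrite !ger0_norm.
apply/negPn/negP => nz; move: hz; apply/negP.
have [z1|z1] := ltP z.1 0.
  (* Left of the quadrant, the ray meets every vertical edge of its row; crossing it means changing
     sides of the line at height [z.2], which is again a coboundary. *)
  rewrite /parity (@eq_xsum (edge U) _ (fun u v => (u.2%:R <= z.2) (+) (v.2%:R <= z.2))) //.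
    by rewrite xsum_telescope lx addbb.
  move=> u v us vs /edge_cases; rewrite /ray_crossing.
  have zn n : z.1 < n%:R by apply: lt_le_trans z1 _.
  case; [case: u us => a b us|case: v vs => a b vs|case: u us => a b us|case: v vs => a b vs]
    => -> /=; rewrite ?eqxx ?zn /=.
  - rewrite -natr1; have [h|h] := leP b%:R z.2; have [h'|h'] := leP (b%:R + 1) z.2 => //=; lra.
  - rewrite -natr1; have [h|h] := leP b%:R z.2; have [h'|h'] := leP (b%:R + 1) z.2 => //=; lra.
  - by rewrite addbb; have -> : a == a.+1 = false by lia.
  - by rewrite addbb; have -> : a.+1 == a = false by lia.
(* Above, below and to the right of the walk, the ray meets no edge at all. *)
rewrite /parity eq_xsum_false // => u v us vs; apply/negP => /and3P[_ zu /orP h].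
have [hu1 hu2] := HM' _ us; have [hv1 hv2] := HM' _ vs.
have u0 := n0 u.2; have v0 := n0 v.2.
move/negP: nz; apply; rewrite z1 /=.
by case: h => /andP[h h']; lra.
Qed.

Lemma row_index b j :
  (b <= j < b.+1)%N || (b.+1 <= j < b)%N = (b == j) && (b.+1 == j.+1) || (b.+1 == j) && (b == j.+1).
Proof.
rewrite ltnS -eqn_leq eqSS andbb; congr orb.
by transitivity false; [|symmetry]; apply/negbTE/negP => /andP[]; lia.
Qed.

Lemma odd_square_sub U x p i j : open U -> (forall A B, ~ splits U A B) ->
  cycle (edge U) (x :: p) -> xsum (crossing i j) x (rcons p x) -> square U (i, j).
Proof.
move=> oU ns cyc odd z z1 z2; apply: contrapT => nUz.
have lx : last x (rcons p x) = x by rewrite last_rcons.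
have lc := parity_locally_constant cyc lx.
have pz : parity z x (rcons p x).
  have [e e0 He] := lc z nUz.
  (* [z] may lie on the boundary of the square. Moved towards the centre, it becomes an interior
     point [w] of the same parity, from which the ray crosses exactly the edges counted by
     [crossing i j]. *)
  pose r := Num.min e (1 / 2).
  have r0 : 0 < r by rewrite lt_min; lra.
  have re : r <= e by rewrite ge_min lexx.
  have r1 : r <= 1 / 2 by rewrite ge_min lexx orbT.
  move: z1 z2 => /= z1 z2.
  pose w : P := ((1 - r) * z.1 + r * (i%:R + 1 / 2), (1 - r) * z.2 + r * (j%:R + 1 / 2)).
  have w1 : i%:R < w.1 < i%:R + 1 by rewrite /=; nra.
  have w2 : j%:R < w.2 < j%:R + 1 by rewrite /=; nra.
  rewrite -(He w); last first.
    by split; rewrite ltr_distl /=; nra.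
  clearbody w.
  suff -> : parity w x (rcons p x) = xsum (crossing i j) x (rcons p x) by [].
  apply: (@eq_xsum (edge U)) => // u v _ _ Euv; rewrite /ray_crossing /crossing.
  have nE (n k : nat) (c : R) : k%:R < c < k%:R + 1 -> (c < n%:R) = (k < n)%N.
    move=> h; have [kn|kn] := ltnP k n.
      by move: kn; rewrite -(ler_nat R) -natr1; lra.
    by apply/negbTE; rewrite -leNgt; move: kn; rewrite -(ler_nat R); lra.
  have nE' (n k : nat) (c : R) : k%:R < c < k%:R + 1 -> (n%:R <= c) = (n <= k)%N.
    by move=> h; rewrite leNgt (nE _ _ _ h) -leqNgt.
  rewrite !(nE _ _ _ w1) !(nE _ _ _ w2) !(nE' _ _ _ w2).
  case: (edge_cases Euv);
    [case: u {Euv} => a b|case: v {Euv} => a b|case: u {Euv} => a b|case: v {Euv} => a b] => -> /=.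
  - by rewrite row_index.
  - by rewrite orbC row_index orbC.
  - by rewrite ltn_eqF.
  - by rewrite gtn_eqF.
(* Parity cuts the complement of [U] into two closed parts; the odd one is bounded and contains
   [z]. *)
apply: (ns (~` U `&` [set w | parity w x (rcons p x)])
           (~` U `&` [set w | ~~ parity w x (rcons p x)])).
have oUb w : U w -> exists2 e : R, 0 < e & forall t, in_box e w t -> U t.
  by move=> Uw; apply/nbhs_box; apply: open_nbhs_nbhs.
split.
- apply: closed_box => w; have [Uw _|nUw] := pselect (U w).
    by have [e e0 He] := oUb w Uw; exists e => // t /He Ut [].
  have [e e0 He] := lc w nUw => h; exists e => // t /He pt [_ /=]; rewrite pt => pw.
  exact: h.
- apply: closed_box => w; have [Uw _|nUw] := pselect (U w).
    by have [e e0 He] := oUb w Uw; exists e => // t /He Ut [].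
  have [e e0 He] := lc w nUw => h; exists e => // t /He pt [_ /=]; rewrite pt => pw.
  exact: h.
- by apply/seteqP; split=> // w [[_ /= h] [_ /=]]; rewrite h.
- apply/seteqP; split=> [w [[]|[]]//|w nUw].
  by case: (boolP (parity w x (rcons p x))) => h; [left|right].
- split; last by exists z.
  have [M HM] := parity_bounded cyc lx.
  by exists M => w [_ /HM].
Qed.

Lemma lattice_loop_null U x s : open U -> (forall A B, ~ splits U A B) ->
  U (emb x) -> path (fun u v => (u == v) || edge U u v) x s -> last x s = x ->
  homotopic U (walk_line x s) (fun=> emb x).
Proof.
move=> oU ns Ux p lx.
have [t [pt lt st]] : exists t, [/\ path (edge U) x t, last x t = last x s &
    walk_equiv (edge U) (square U) (x :: s) (x :: t)].
  elim: s x p {lx Ux} => [|y s IH] x /=.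
    by exists [::]; split=> //; exact: walk_equiv_refl.
  case/andP => xy /IH [t [pt lt st]].
  have [xE|xN] := eqVneq x y.
    exists t; rewrite xE; split=> //.
    exact: walk_equiv_trans (@walk_equiv_stutter _ _ [::] y s) st.
  move: xy; rewrite (negbTE xN) /= => xy.
  exists (y :: t); split=> //=; first by rewrite xy.
  by have := walk_equiv_context [:: x] [::] st; rewrite !cats0.
have nt : walk_equiv (edge U) (square U) (x :: t) [:: x].
  case/lastP: t pt lt {st} => [|t y] pt; first by move=> _; exact: walk_equiv_refl.
  rewrite lx last_rcons => yx; rewrite yx in pt *.
  apply: (@cycle_null (edge U) (square U) _ _ _ _ (x :: t)) => //.
  - exact: edge_sym.
  - exact: edge_adjacent.
  - exact: square_edge.
  - by move=> ? ? ? ?; exact: odd_square_sub.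
have [_ e h] := walk_equiv_sound (walk_equiv_trans st nt).
have := h ((iffRL e) Ux).
by rewrite /walk_line /polyline /=.
Qed.

End Parity.

(** * Lattice approximation of loops *)

(** [Q] is asked for all small [e] near each point, so compactness yields a common [e] without
    monotonicity. Using the inverse of [e] in [Q] also gives bounds. *)
Lemma compact_uniform (R : realType) (T : topologicalType) (K : set T) (Q : R -> T -> Prop) :
  compact K ->
  (forall x, K x -> exists2 d : R, 0 < d &
     \forall y \near x, forall e : R, 0 < e < d -> Q e y) ->
  exists2 e : R, 0 < e & forall x, K x -> Q e x.
Proof.
move=> /compact_near_coveringP/(_ R (0^'+)%classic Q _) cK H.
have : \forall e \near (0 : R)^'+, K `<=` Q e.
  apply: cK => x Kx; have [d d0 Hd] := H x Kx.
  exists ([set y | forall e : R, 0 < e < d -> Q e y], [set e | 0 < e < d]) => /=.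
    split; first exact: Hd.
    by near=> e => /=; apply/andP; split.
  by move=> [y e] [/= h he]; exact: h.
move=> h; near (0 : R)^'+ => e; exists e => //.
by move=> x Kx; apply: (near h e).
Unshelve. all: by end_near. Qed.

Section Approximation.
Context {R : realType}.
Local Notation P := (R * R)%type.
Local Notation vertex := (nat * nat)%type.
Implicit Types (U A B : set P) (z w : P) (g : R -> P).

Let I01 : set R := `[0, 1]%classic.

Lemma I01P (t : R) : I01 t <-> 0 <= t <= 1.
Proof. by rewrite /I01 /= in_itv. Qed.

Lemma lerp_oitv (a b x y t : R) : 0 <= t <= 1 -> a < x < b -> a < y < b ->
  a < (1 - t) * x + t * y < b.
Proof.
move=> t01 xab yab.
have mx : Num.min x y <= x <= Num.max x y by rewrite ge_min le_max !lexx.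
have my : Num.min x y <= y <= Num.max x y by rewrite ge_min le_max !lexx !orbT.
have /andP[h1 h2] := lerp_itv t01 mx my.
apply/andP; split; [apply: lt_le_trans _ h1|apply: le_lt_trans h2 _].
  by rewrite lt_min; lra.
by rewrite gt_max; lra.
Qed.

Lemma in_box_lerp (e s : R) z x y : 0 <= s <= 1 -> in_box e z x -> in_box e z y ->
  in_box e z (lerp s x y).
Proof.
rewrite /in_box !ltr_distl => s01 [/andP[? ?] /andP[? ?]] [/andP[? ?] /andP[? ?]].
by split; apply: lerp_oitv => //; lra.
Qed.

Lemma in_box_refl (e : R) z : 0 < e -> in_box e z z.
Proof. by move=> e0; rewrite /in_box !subrr normr0. Qed.

Lemma cont_box g (t e : R) : continuous g -> 0 < e ->
  exists2 d : R, 0 < d & forall t', `|t' - t| < d -> in_box e (g t) (g t').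
Proof.
move=> cg e0; have : nbhs (g t) [set w | in_box e (g t) w].
  by apply/nbhs_box; exists e.
move=> /(cg t) /nbhs_ballP [d /= d0 H]; exists d => // t' tt'.
by apply: H; rewrite /ball /= distrC.
Qed.

Lemma tube_radius U g : open U -> continuous g -> (forall t : R, 0 <= t <= 1 -> U (g t)) ->
  exists2 e : R, 0 < e & forall t : R, 0 <= t <= 1 -> forall w, in_box e (g t) w -> U w.
Proof.
move=> oU cg Ug.
have [t /I01P t01|e e0 H] := @compact_uniform _ _ I01
  (fun e t => forall w, in_box e (g t) w -> U w) (@segment_compact _ _ _).
  have /nbhs_box[e e0 He] : nbhs (g t) U by apply: open_nbhs_nbhs; split=> //; exact: Ug.
  have e20 : 0 < e / 2 by rewrite divr_gt0.
  exists (e / 2) => //; have [d d0 Hd] := cont_box t cg e20.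
  apply/nbhs_ballP; exists d => // t' tt' r r0 w [w1 w2]; apply: He.
  have [] := Hd t'; first by rewrite distrC.
  move: w1 w2 r0; rewrite !ltr_distl => /andP[? ?] /andP[? ?] /andP[? ?] /andP[? ?] /andP[? ?].
  by split; rewrite ltr_distl; lra.
by exists e => // t /I01P; exact: H.
Qed.

Lemma path_bounded g : continuous g ->
  exists M : R, forall t : R, 0 <= t <= 1 -> in_box M (g 0) (g t).
Proof.
move=> cg.
have [t /I01P t01|e e0 H] := @compact_uniform _ _ I01
  (fun e t => in_box (e^-1) (g 0) (g t)) (@segment_compact _ _ _).
  pose b := `|(g t).1 - (g 0).1| + `|(g t).2 - (g 0).2| + 1.
  have b0 : 0 < b by rewrite ltr_wpDl // addr_ge0.
  exists b^-1; first by rewrite invr_gt0.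
  have [d d0 Hd] := cont_box t cg ltr01.
  apply/nbhs_ballP; exists d => // t' tt' r /andP[r0 rb].
  have br : b < r^-1 by rewrite -[b]invrK ltf_pV2 ?posrE ?invr_gt0.
  have [] := Hd t'; first by rewrite distrC.
  move=> h1 h2; split; apply: lt_trans br; rewrite /b.
    apply: le_lt_trans (ler_distD (g t).1 _ _) _; move: h1 (normr_ge0 ((g t).2 - (g 0).2)); lra.
  apply: le_lt_trans (ler_distD (g t).2 _ _) _; move: h2 (normr_ge0 ((g t).1 - (g 0).1)); lra.
by exists e^-1 => t /I01P; exact: H.
Qed.

Lemma path_unif g (eta : R) : continuous g -> 0 < eta ->
  exists2 d : R, 0 < d & forall t : R, 0 <= t <= 1 -> forall t' : R, `|t' - t| < d ->
    in_box eta (g t) (g t').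
Proof.
move=> cg eta0.
have [t /I01P t01|e e0 H] := @compact_uniform _ _ I01
  (fun e t => forall t' : R, `|t' - t| < e -> in_box eta (g t) (g t')) (@segment_compact _ _ _).
  have e20 : 0 < eta / 2 by rewrite divr_gt0.
  have [d d0 Hd] := cont_box t cg e20.
  exists (d / 2); first by rewrite divr_gt0.
  apply/nbhs_ballP; exists (d / 2); first by rewrite /= divr_gt0.
  move=> u; rewrite /ball /= distrC => tu r /andP[r0 rd] t' ut'.
  have [|u1 u2] := Hd u; first by lra.
  have [|t1 t2] := Hd t'.
    by apply: le_lt_trans (ler_distD u _ _) _; lra.
  move: u1 u2 t1 t2; rewrite !ltr_distl => /andP[? ?] /andP[? ?] /andP[? ?] /andP[? ?].
  by split; rewrite ltr_distl; lra.
by exists e => // t /I01P; exact: H.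
Qed.

Lemma poly_map_iota (V : nat -> P) n k (t : R) : (k < n)%N -> k%:R <= t <= k%:R + 1 ->
  poly (V 0%N) (map V (iota 1 n)) t = lerp (t - k%:R) (V k) (V k.+1).
Proof.
move=> kn tk; rewrite (_ : n = (k + (n - k.+1).+1)%N); last by lia.
rewrite iotaD map_cat poly_cat_ge size_map size_iota; last by lra.
rewrite [iota _ _.+1]/= map_cons poly_le1 ?add1n; last by lra.
congr lerp; case: k {kn tk} => [//|k].
by rewrite -[k.+1]addn1 iotaD map_cat last_cat /= add1n addn1.
Qed.

Lemma subdivision_index n (u : R) : (0 < n)%N -> 0 <= u <= n%:R ->
  exists2 k, (k < n)%N & k%:R <= u <= k%:R + 1.
Proof.
elim: n => [//|n IH _]; case: n IH => [_|n IH] u01.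
  by exists 0%N => //; lra.
have [h|h] := leP u n.+1%:R.
  have [||k kn hk] := IH => //; first by lra.
  by exists k => //; rewrite ltnS ltnW.
by exists n.+1 => //; move: u01; rewrite -[n.+2%:R]natr1; lra.
Qed.

Lemma truncn_close (a b : R) : 0 <= a -> 0 <= b -> `|a - b| < 1 ->
  [\/ Num.truncn a = Num.truncn b, (Num.truncn a).+1 = Num.truncn b |
      Num.truncn a = (Num.truncn b).+1].
Proof.
move=> a0 b0; rewrite ltr_distl => /andP[h1 h2].
have /andP[a1 a2] := truncn_itv a0; have /andP[b1 b2] := truncn_itv b0.
have : (Num.truncn a < (Num.truncn b).+2)%N.
  by rewrite -(ltr_nat R) -natr1; lra.
have : (Num.truncn b < (Num.truncn a).+2)%N.
  by rewrite -(ltr_nat R) -natr1; lra.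
move=> *; have [|[|]] : Num.truncn a = Num.truncn b \/ (Num.truncn a).+1 = Num.truncn b \/
  Num.truncn a = (Num.truncn b).+1 by lia.
- exact: Or31. - exact: Or32. - exact: Or33.
Qed.

Lemma in_box_onseg (e : R) z u v w : in_box e z (emb u) -> in_box e z (emb v) ->
  onseg u v w -> in_box e z w.
Proof.
rewrite /in_box !ltr_distl /= => -[/andP[? ?] /andP[? ?]] [/andP[? ?] /andP[? ?]] [h1 h2].
split.
  by case: h1 => /andP[? ?]; lra.
by case: h2 => /andP[? ?]; lra.
Qed.

(** The unit lattice suffices in a tube of radius 2: rounding down costs at most 1 in each
    coordinate, and the lag between sample times less than 1. *)
Lemma fine_loop_null U g x : open U -> (forall A B, ~ splits U A B) -> continuous g ->
  g 0 = emb x -> g 1 = emb x -> (forall t : R, 0 <= t <= 1 -> 0 <= (g t).1 /\ 0 <= (g t).2) ->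
  (forall t : R, 0 <= t <= 1 -> forall w, in_box 2 (g t) w -> U w) ->
  homotopic U g (fun=> emb x).
Proof.
move=> oU ns cg g0 g1 gp tube.
have [d d0 Hd] := path_unif cg ltr01.
have [N N0 Nd] : exists2 N : nat, (0 < N)%N & N%:R^-1 < d.
  exists (Num.truncn d^-1).+1 => //.
  by rewrite -[ltRHS]invrK ltf_pV2 ?posrE ?invr_gt0 //; exact: truncnS_gt.
have NR : 0 < N%:R :> R by rewrite ltr0n.
pose tm (j : nat) : R := j%:R / N%:R.
(* Between two samples the first coordinate is updated before the second, so consecutive vertices
   differ in at most one coordinate, by at most 1. *)
pose V k : vertex := (Num.truncn (g (tm (uphalf k))).1, Num.truncn (g (tm k./2)).2).
have tm01 j : (j <= N)%N -> 0 <= tm j <= 1.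
  by move=> jN; rewrite /tm divr_ge0 //= ler_pdivrMr // mul1r ler_nat.
have truncP (a : R) : 0 <= a -> `|(Num.truncn a)%:R - a| <= 1.
  by move=> a0; have /andP[a1 a2] := truncn_itv a0; rewrite -natr1 in a2; rewrite ler_distl; lra.
have Vclose k t : (k <= N.*2)%N -> 0 <= t <= 1 -> `|tm (uphalf k) - t| <= N%:R^-1 ->
    `|tm k./2 - t| <= N%:R^-1 -> in_box 2 (g t) (emb (V k)).
  move=> kN t01 h1 h2.
  have k1 : (uphalf k <= N)%N by lia.
  have k2 : (k./2 <= N)%N by lia.
  have [a1 _] := Hd t t01 _ (le_lt_trans h1 Nd).
  have [_ a2] := Hd t t01 _ (le_lt_trans h2 Nd).
  have b1 := truncP _ (gp _ (tm01 _ k1)).1.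
  have b2 := truncP _ (gp _ (tm01 _ k2)).2.
  split; rewrite /emb /=.
    by apply: le_lt_trans (ler_distD (g (tm (uphalf k))).1 _ _) _; lra.
  by apply: le_lt_trans (ler_distD (g (tm k./2)).2 _ _) _; lra.
(* In the [k]-th of the [2 N] time steps, all sample times used by [V k] and [V k.+1] are within
   [1 / N] of [t]. *)
have tmclose k j t : k%:R <= N.*2%:R * t <= k%:R + 1 -> (k <= j.*2.+1)%N -> (j.*2 <= k.+2)%N ->
    `|tm j - t| <= N%:R^-1.
  rewrite -(ler_nat R k) -(ler_nat R _ k.+2) -!natr1 -!muln2 !natrM => h1 h2 h3.
  have -> : tm j - t = (j%:R - N%:R * t) / N%:R.
    by rewrite /tm mulrBl mulrAC divff ?lt0r_neq0 // mul1r.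
  have Ni : 0 <= N%:R^-1 :> R by rewrite invr_ge0 ltW.
  rewrite normrM [`|N%:R^-1|]ger0_norm //; apply: ler_piMl => //.
  by rewrite ler_norml; lra.
have Vnear k t : (k < N.*2)%N -> 0 <= t <= 1 -> k%:R <= N.*2%:R * t <= k%:R + 1 ->
    in_box 2 (g t) (emb (V k)) /\ in_box 2 (g t) (emb (V k.+1)).
  by move=> kN t01 kt; split; apply: Vclose => //; try (apply: tmclose kt _ _); lia.
have V0 : V 0%N = x.
  by rewrite /V /tm /= mul0r g0 /emb /= !natrK; case: (x).
have VN : V N.*2 = x.
  rewrite /V /tm uphalf_double doubleK divff ?lt0r_neq0 // g1 /emb /= !natrK; by case: (x).
pose s := map V (iota 1 N.*2).
have ls : last x s = x.
  have -> : s = rcons (map V (iota 1 N.*2.-1)) x.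
    have e : N.*2 = (N.*2.-1 + 1)%N by rewrite addn1 prednK // double_gt0.
    by rewrite /s {1}e iotaD map_cat cats1 -VN; congr (rcons _ (V _)); rewrite [RHS]e addnC.
  by rewrite last_rcons.
have size_s : size s = N.*2 by rewrite /s size_map size_iota.
have N2 : 0 < N.*2%:R :> R by rewrite ltr0n double_gt0.
have time k : (k < N.*2)%N -> let t : R := k%:R / N.*2%:R in
    0 <= t <= 1 /\ k%:R <= N.*2%:R * t <= k%:R + 1.
  move=> kN t; have -> : N.*2%:R * t = k%:R by rewrite mulrC divfK ?lt0r_neq0.
  split; last by lra.
  by rewrite /t divr_ge0 //= ler_pdivrMr // mul1r ler_nat ltnW.
have ps : path (fun u v => (u == v) || edge U u v) x s.
  rewrite -{1}V0 /s.
  suff H n m : (m + n <= N.*2)%N ->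
      path (fun u v => (u == v) || edge U u v) (V m) (map V (iota m.+1 n)) by apply: H.
  elim: n m => [//|n IH] m mn /=; rewrite IH ?andbT; last by lia.
  have mN : (m < N.*2)%N by lia.
  have [t01 tm'] := time m mN; have [n1 n2] := Vnear m _ mN t01 tm'.
  case: (eqVneq (V m) (V m.+1)) => //= nE; apply/andP; split; last first.
    by apply/asboolP => w ow; apply: (tube _ t01); apply: in_box_onseg n1 n2 ow.
  have st j : (j < N)%N -> in_box 1 (g (tm j)) (g (tm j.+1)).
    move=> jN; apply: Hd; first exact: tm01 (ltnW jN).
    by rewrite /tm -natr1 mulrDl addrAC subrr add0r mul1r ger0_norm ?invr_ge0 // ltW.
  have pos j : (j <= N)%N -> 0 <= (g (tm j)).1 /\ 0 <= (g (tm j)).2.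
    by move=> /tm01; exact: gp.
  move: nE; rewrite /V /adjacent /=.
  have jN : (m./2 < N)%N.
    by rewrite -ltn_double (leq_ltn_trans _ mN) // -[leqRHS]odd_double_half leq_addl.
  have [s1 s2] := st _ jN; have [p1 p2] := pos _ (ltnW jN); have [q1 q2] := pos _ jN.
  have [->|->] : uphalf m = m./2 \/ uphalf m = m./2.+1.
  - by rewrite uphalf_half; case: odd; [right|left].
  - by rewrite xpair_eqE; case: (truncn_close q1 p1 s1); clear; lia.
  - by rewrite xpair_eqE; case: (truncn_close q2 p2 s2); clear; lia.
have Ux : U (emb x).
  by apply: (tube 0); rewrite ?lexx ?ler01 // g0; exact: in_box_refl.
apply: homotopic_trans (lattice_loop_null oU ns Ux ps ls).
  exact: cont_polyline.
apply: homotopic_lerp => //.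
- exact: cont_polyline.
- by rewrite /walk_line polyline0.
- by rewrite /walk_line polyline1 last_map ls.
move=> t r t01 r01; apply: (tube _ t01); apply: in_box_lerp => //; first exact: in_box_refl.
rewrite /walk_line /polyline size_map size_s.
have [||k kN kt] := @subdivision_index N.*2 (N.*2%:R * t).
  by rewrite double_gt0.
  by case/andP: t01 => t0 t1; rewrite mulr_ge0 //= ler_piMr.
have [n1 n2] := Vnear k t kN t01 kt.
have -> : emb x = emb (V 0%N) by rewrite V0.
rewrite /s -map_comp (@poly_map_iota (emb \o V) _ k) //.
by apply: in_box_lerp => //; lra.
Qed.

Lemma nonsplit_loop_null U g : open U -> (forall A B, ~ splits U A B) -> continuous g ->
  g 1 = g 0 -> (forall t : R, 0 <= t <= 1 -> U (g t)) -> homotopic U g (fun=> g 0).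
Proof.
move=> oU ns cg g1 Ug.
have [e e0 tube] := tube_radius oU cg Ug.
have [M0 HM0] := path_bounded cg.
(* The change of scale [f] below sends mesh 1 to [d], hence a tube of radius 2 to one of radius [e],
   and the vertex [(M, M)] to [g 0]; [M] is large enough to put the rescaled loop into the first
   quadrant. *)
pose d := e / 2; have d0 : 0 < d by rewrite divr_gt0.
pose M := (Num.truncn (M0 / d)).+1.
have HM (t : R) : 0 <= t <= 1 -> in_box (M%:R * d) (g 0) (g t).
  have M0M : M0 < M%:R * d by rewrite -ltr_pdivrMr //; exact: truncnS_gt.
  by move=> /HM0[h1 h2]; split; [apply: lt_trans h1 _|apply: lt_trans h2 _].
pose f (z : P) : P := ((g 0).1 + d * (z.1 - M%:R), (g 0).2 + d * (z.2 - M%:R)).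
pose h (z : P) : P := ((z.1 - (g 0).1) / d + M%:R, (z.2 - (g 0).2) / d + M%:R).
have cf : continuous f by rewrite /f; cont.
have ch : continuous h by rewrite /h; cont.
have dn0 : d != 0 by rewrite gt_eqF.
have hf z : h (f z) = z.
  rewrite /h /f /= [(g 0).1 + _]addrC [(g 0).2 + _]addrC !addrK ![d * _]mulrC !mulfK //.
  by rewrite !subrK -surjective_pairing.
have fh z : f (h z) = z.
  rewrite /h /f /= !addrK ![d * _]mulrC !divfK //.
  by rewrite [(g 0).1 + _]addrC [(g 0).2 + _]addrC !subrK -surjective_pairing.
have [H [cH UH H1 H2]] : homotopic (f @^-1` U) (fun t => h (g t)) (fun=> emb (M, M)).
  have hg0 : h (g 0) = emb (M, M) by rewrite /h /emb !subrr !mul0r !add0r.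
  apply: fine_loop_null => //; last 3 first.
  - by rewrite g1.
  - move=> t /HM[]; rewrite !ltr_distl => /andP[h1 _] /andP[h2 _]; split => /=.
      by rewrite -lerBlDr sub0r ler_pdivlMr // mulNr; lra.
    by rewrite -lerBlDr sub0r ler_pdivlMr // mulNr; lra.
  - move=> t t01 w [w1 w2]; apply: (tube t t01).
    have E (a b c : R) : c + d * (a - M%:R) - b = d * (a - ((b - c) / d + M%:R)).
      by field; rewrite ?dn0.
    have dE : e = d * 2 by rewrite /d divfK.
    by split; rewrite /f /= E normrM (gtr0_norm d0) dE ltr_pM2l.
  - by apply: open_comp => // z _; exact: cf.
  - move=> A B [cA cB AB0 ABU [[K HK] [a Aa]]].
    apply: (ns (h @^-1` A) (h @^-1` B)); split.
    + by apply: preimage_closed => // z _; exact: ch.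
    + by apply: preimage_closed => // z _; exact: ch.
    + by rewrite -preimage_setI AB0 preimage_set0.
    + by rewrite -preimage_setU ABU; apply/seteqP; split => z /=; rewrite fh.
    + split; last by exists (f a) => /=; rewrite hf.
      exists (`|(g 0).1| + `|(g 0).2| + d * (K + M%:R)) => z /= /HK[k1 k2].
      have B0 (a' c c' : R) : `|(a' - c) / d + M%:R| <= K -> `|a'| <= `|c| + `|c'| + d * (K + M%:R).
        move=> k; have -> : a' = c + d * ((a' - c) / d + M%:R - M%:R) by field.
        apply: le_trans (ler_normD _ _) _; rewrite -[leRHS]addrA lerD2l.
        rewrite normrM (gtr0_norm d0) -[leLHS]add0r lerD // ler_pM2l //.
        apply: le_trans (ler_normB _ _) _; rewrite lerD //.
        by rewrite ger0_norm.
      by split; [exact: B0|rewrite [`|(g 0).1| + _]addrC; exact: B0].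
  - by apply: (cont_comp ch).
exists (fun p => f (H p)); split.
- exact: cont_comp.
- exact: UH.
- move=> t t01; have [-> ->] := H1 t t01.
  by rewrite fh /f /emb /= !subrr !mulr0 !addr0 -surjective_pairing.
- by move=> r r01; have [-> ->] := H2 r r01; rewrite !fh.
Qed.

End Approximation.

(** * Continuous arguments *)

Section Argument.
Context {R : realType}.
Local Notation P := (R * R)%type.
Implicit Types (u w z : P) (a b : R).

Definition cis a : P := (cos a, sin a).

Definition unitary w := w.1 ^+ 2 + w.2 ^+ 2 = 1.

(* The quotient [w / u] of two unit complex numbers, i.e. [w * conj u]. *)
Definition ratio w u : P := (w.1 * u.1 + w.2 * u.2, w.2 * u.1 - w.1 * u.2).

Lemma unitary_cis a : unitary (cis a).
Proof. exact: cos2Dsin2. Qed.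

Lemma cis0 : cis 0 = (1, 0).
Proof. by rewrite /cis cos0 sin0. Qed.

Lemma unitary_ratio w u : unitary w -> unitary u -> unitary (ratio w u).
Proof.
rewrite /unitary /ratio /= => hw hu.
by rewrite -[RHS]mulr1 -{1}hw -hu; ring.
Qed.

Lemma ratio_self w : unitary w -> ratio w w = (1, 0).
Proof. by rewrite /unitary /ratio => <-; congr pair; ring. Qed.

Lemma cisD_ratio a b u w : unitary u -> cis a = u -> cis b = ratio w u -> cis (a + b) = w.
Proof.
case: u w => [u1 u2] [w1 w2]; rewrite /unitary /cis /ratio cosD sinD /=.
move=> uu [-> ->] [-> ->].
by congr pair; rewrite -[RHS]mulr1 -uu; ring.
Qed.

Lemma ratio_cis a b : ratio (cis a) (cis b) = cis (a - b).
Proof. by rewrite /ratio /cis /= cosB sinB; congr pair; ring. Qed.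

Lemma cis_asin w : unitary w -> 0 < w.1 -> cis (asin w.2) = w.
Proof.
rewrite /unitary => uw w0; have w2 : -1 <= w.2 <= 1 by nra.
rewrite /cis cos_asin // (_ : 1 - w.2 ^+ 2 = w.1 ^+ 2); last by rewrite -uw addrK.
by rewrite sqrtr_sqr gtr0_norm // asinK ?in_itv //= -surjective_pairing.
Qed.

Lemma arg_exists w : unitary w -> exists a, cis a = w.
Proof.
rewrite /unitary => uw; have w1 : -1 <= w.1 <= 1 by nra.
have E : Num.sqrt (1 - w.1 ^+ 2) = `|w.2|.
  by rewrite (_ : 1 - w.1 ^+ 2 = w.2 ^+ 2) ?sqrtr_sqr // -uw addrC addKr.
have [h|h] := leP 0 w.2.
  exists (acos w.1); rewrite /cis sin_acos // acosK ?in_itv //= E ger0_norm //.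
  by rewrite -surjective_pairing.
exists (- acos w.1); rewrite /cis cosN sinN sin_acos // acosK ?in_itv //= E ltr0_norm //.
by rewrite opprK -surjective_pairing.
Qed.

Lemma continuous_asin_snd (T : topologicalType) (q : T -> P) (x : T) :
  {for x, continuous q} -> unitary (q x) -> 0 < (q x).1 ->
  {for x, continuous (fun y => asin (q y).2)}.
Proof.
move=> cq; rewrite /unitary => uq q0; apply: (@continuous_comp _ _ _ (fun y => (q y).2)).
  by apply: (cvg_comp _ _ cq); exact: cvg_snd.
by apply: continuous_asin; nra.
Qed.

Lemma cont_cis (T : topologicalType) (f : T -> R) : continuous f -> continuous (fun x => cis (f x)).
Proof.
move=> cf; apply: cont_pair.
  exact: (cont_comp (@continuous_cos R) cf).
exact: (cont_comp (@continuous_sin R) cf).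
Qed.

(* A continuous determination of the argument [0] cannot take two values: by
   the intermediate value theorem it would also take one at distance less
   than [pi] from the first. *)
Lemma cis1_const (d : R -> R) : continuous d ->
  (forall t : R, 0 <= t <= 1 -> cis (d t) = (1, 0)) -> d 1 = d 0.
Proof.
move=> cd d1; apply/eqP/negPn/negP => ne.
have d01 : `|d 1 - d 0| > 0 by rewrite normr_gt0 subr_eq0.
pose s := Num.sg (d 1 - d 0).
(* A value at positive distance at most 1 from [d 0]; as 1 is less than pi, the sine of the
   difference cannot vanish. *)
pose v := d 0 + s * Num.min `|d 1 - d 0| 1.
have m0 : 0 < Num.min `|d 1 - d 0| 1 by rewrite lt_min d01 ltr01.
have m1 : Num.min `|d 1 - d 0| 1 <= 1 by rewrite ge_min lexx orbT.
have md : Num.min `|d 1 - d 0| 1 <= `|d 1 - d 0| by rewrite ge_min lexx.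
have pi2 := @pi_ge2 R.
have [|t t01 tv] := @IVT R d 0 1 v ler01 (continuous_subspaceT cd).
  rewrite /v /s; move: m0 m1 md; set m := Num.min _ _.
  have [h|h] := ltP (d 0) (d 1).
    rewrite gtr0_sg ?subr_gt0 // gtr0_norm ?subr_gt0 // => *.
    lra.
  have {}h : d 1 < d 0 by rewrite lt_neqAle h ne.
  rewrite ltr0_sg ?subr_lt0 // ltr0_norm ?subr_lt0 // => *.
  lra.
rewrite in_itv /= in t01; have := d1 t t01; rewrite tv => -[cv sv].
have [c0 s0] : cos (d 0) = 1 /\ sin (d 0) = 0.
  by have := d1 0; rewrite lexx ler01 => /(_ isT) [].
have : sin (s * Num.min `|d 1 - d 0| 1) = 0.
  have -> : s * Num.min `|d 1 - d 0| 1 = v - d 0 by rewrite /v addrAC subrr add0r.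
  by rewrite sinB c0 s0 cv sv; ring.
rewrite sin_sg => /eqP; rewrite mulf_eq0 sgr_eq0 subr_eq0 (negbTE ne) /=.
by apply/negP; rewrite gt_eqF // sin_gt0_pi // m0 /=; lra.
Qed.

Lemma lift_diff (l l' : R -> R) : continuous l -> continuous l' ->
  (forall t : R, 0 <= t <= 1 -> cis (l t) = cis (l' t)) -> l 1 - l' 1 = l 0 - l' 0.
Proof.
move=> cl cl' E; apply: (@cis1_const (fun t => l t - l' t)); first by cont.
move=> t /E h; rewrite -ratio_cis h ratio_self //; exact: unitary_cis.
Qed.

Lemma cont_ratio (T : topologicalType) (f g : T -> P) : continuous f -> continuous g ->
  continuous (fun x => ratio (f x) (g x)).
Proof. by move=> cf cg; rewrite /ratio; cont. Qed.

Definition csq (p : R * R) : R * R := (clamp p.1, clamp p.2).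

(** For unit vectors the first coordinate of the quotient is [1 - |u - w|^2 / 2]. Its positivity
    makes [asin] a continuous argument of the quotient. *)
Lemma ratio_close w u : unitary w -> unitary u -> in_box (1 / 2) w u -> 0 < (ratio u w).1.
Proof.
rewrite /unitary /in_box !ltr_distl /= => hw hu [/andP[? ?] /andP[? ?]].
have : (u.1 - w.1) ^+ 2 < 1 by nra.
have : (u.2 - w.2) ^+ 2 < 1 by nra.
by move=> *; nra.
Qed.

(* Travel from [h 0] to [h p] along the ray through [p] in small steps, and add
   up the small arguments of the successive quotients. *)
Lemma lift_square (h : R * R -> P) : continuous h -> (forall p, unitary (h p)) ->
  exists2 L : R * R -> R, continuous L & forall p, cis (L p) = h (csq p).
Proof.
move=> ch uh; pose K : set (R * R) := `[0, 1]%classic `*` `[0, 1]%classic.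
have cK : compact K by apply: compact_setX; exact: segment_compact.
have [p _|e e0 He] := @compact_uniform _ _ K
  (fun e p => forall q, in_box e p q -> in_box (1 / 2) (h p) (h q)) cK.
  have : nbhs (h p) [set w | in_box (1 / 4) (h p) w].
    by apply/nbhs_box; exists (1 / 4).
  move=> /(ch p) /nbhs_box [d d0 Hd]; exists (d / 2); first by rewrite divr_gt0.
  apply/nbhs_box; exists (d / 2); first by rewrite divr_gt0.
  move=> p' pp' r /andP[r0 rd] q p'q.
  have [|a1 a2] := Hd p'.
    by move: pp'; rewrite /in_box !ltr_distl => -[/andP[? ?] /andP[? ?]]; split; lra.
  have [|b1 b2] := Hd q.
    move: pp' p'q; rewrite /in_box !ltr_distl.
    by move=> -[/andP[? ?] /andP[? ?]] [/andP[? ?] /andP[? ?]]; split; lra.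
  move: a1 a2 b1 b2; rewrite /in_box !ltr_distl.
  by move=> /andP[? ?] /andP[? ?] /andP[? ?] /andP[? ?]; split; lra.
pose n := (Num.truncn e^-1).+1.
have n0 : 0 < n%:R :> R by rewrite ltr0n.
have ne : n%:R^-1 < e.
  by rewrite -[ltRHS]invrK ltf_pV2 ?posrE ?invr_gt0 //; exact: truncnS_gt.
pose sc k (p : R * R) : R * R := (k%:R / n%:R * clamp p.1, k%:R / n%:R * clamp p.2).
have csc k : continuous (sc k) by rewrite /sc; contc.
have step k p : (k < n)%N -> 0 < (ratio (h (sc k.+1 p)) (h (sc k p))).1.
  move=> kn; apply: ratio_close; [exact: uh|exact: uh|].
  have k01 : 0 <= (k%:R / n%:R : R) <= 1.
    by rewrite divr_ge0 //= ler_pdivrMr // mul1r ler_nat ltnW.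
  have Kc (t : R) : 0 <= k%:R / n%:R * clamp t <= 1.
    have := clamp_ge0 t; have := clamp_le1 t; move: k01; set x := k%:R / _; set y := clamp t.
    by move=> *; nra.
  apply: He; first by split; rewrite /= in_itv /= Kc.
  have D (t : R) : `|k.+1%:R / n%:R * clamp t - k%:R / n%:R * clamp t| < e.
    rewrite -mulrBl -mulrBl -natr1 addrAC subrr add0r mul1r.
    rewrite ger0_norm; last by rewrite mulr_ge0 ?clamp_ge0 // invr_ge0 ltW.
    apply: le_lt_trans ne; apply: ler_piMr; last exact: clamp_le1.
    by rewrite invr_ge0 ltW.
  by split; exact: D.
suff [L cL HL] : exists2 L : R * R -> R, continuous L & forall p, cis (L p) = h (sc n p).
  by exists L => // p; rewrite HL /sc /csq divff ?gt_eqF // !mul1r.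
have : (n <= n)%N by [].
elim: {-2}n => [_|m IH mn].
  have [a Ha] := arg_exists (uh (0, 0)).
  by exists (fun=> a); [exact: cst_continuous|move=> p; rewrite Ha /sc !mul0r].
have [L cL HL] := IH (ltnW mn).
exists (fun p => L p + asin (ratio (h (sc m.+1 p)) (h (sc m p))).2).
  apply: cont_add => // p.
  apply: (@continuous_asin_snd _ (fun p => ratio (h (sc m.+1 p)) (h (sc m p))) p).
  - by apply: cont_ratio; apply: (cont_comp ch).
  - exact: unitary_ratio.
  - exact: step.
move=> p; apply: (cisD_ratio (uh (sc m p))); first exact: HL.
by apply: cis_asin; [exact: unitary_ratio|exact: step].
Qed.

End Argument.

(** * Monodromy *)

Section Paths.
Context {R : realType}.
Local Notation P := (R * R)%type.
Implicit Types (U A B : set P) (x y z w : P) (g : R -> P).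

(** The path stays in [U] at all real times, not only in the unit interval, so that its composition
    with a function continuous on [U] is continuous on the whole line. *)
Definition good_path U x y g :=
  [/\ continuous g, forall t, U (g t), g 0 = x & g 1 = y].

Definition joined U x y := exists g, good_path U x y g.

(** Glued additively, as in [homotopic_trans]; when the ends meet, [concatE] gives back the usual
    concatenation. *)
Definition concat g1 g2 (t : R) : P :=
  ((g1 (clamp (2 * t))).1 + (g2 (clamp (2 * t - 1))).1 - (g1 1).1,
   (g1 (clamp (2 * t))).2 + (g2 (clamp (2 * t - 1))).2 - (g1 1).2).

Lemma cont_concat g1 g2 : continuous g1 -> continuous g2 -> continuous (concat g1 g2).
Proof.
move=> c1 c2; have k1 : continuous (fun t : R => g1 (clamp (2 * t))).
  by apply: (cont_comp c1); contc.
have k2 : continuous (fun t : R => g2 (clamp (2 * t - 1))).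
  by apply: (cont_comp c2); contc.
by rewrite /concat; cont.
Qed.

Lemma concatE g1 g2 (t : R) : g1 1 = g2 0 -> concat g1 g2 t =
  if t <= 1 / 2 then g1 (clamp (2 * t)) else g2 (clamp (2 * t - 1)).
Proof.
move=> e; rewrite /concat; case: ifPn => h.
  rewrite [clamp (2 * t - 1)]clamp_lt0; last by lra.
  by rewrite -e !addrK -surjective_pairing.
rewrite [clamp (2 * t)]clamp_gt1; last by lra.
by rewrite ![(g1 1).1 + _]addrC ![(g1 1).2 + _]addrC !addrK -surjective_pairing.
Qed.

Lemma concat0 g1 g2 : g1 1 = g2 0 -> concat g1 g2 0 = g1 0.
Proof. by move=> e; rewrite concatE // divr_ge0 // mulr0 clamp_id ?ler01. Qed.

Lemma concat1 g1 g2 : g1 1 = g2 0 -> concat g1 g2 1 = g2 1.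
Proof.
move=> e; rewrite concatE // ifF; last by apply/negbTE; rewrite -ltNge; lra.
by rewrite clamp_gt1 //; lra.
Qed.

Lemma good_path_concat U x y z g1 g2 : good_path U x y g1 -> good_path U y z g2 ->
  good_path U x z (concat g1 g2).
Proof.
move=> [c1 U1 <- e1] [c2 U2 e2 <-]; have e : g1 1 = g2 0 by rewrite e1 e2.
split; [exact: cont_concat| |exact: concat0|exact: concat1].
by move=> t; rewrite concatE //; case: ifP.
Qed.

Lemma good_path_rev U x y g : good_path U x y g -> good_path U y x (fun t => g (1 - t)).
Proof.
move=> [c Ug g0 g1]; split; rewrite ?subr0 ?subrr //.
by apply: (@cont_comp R _ _ g (fun t : R => 1 - t) c); cont.
Qed.

Lemma good_path_seg U x y : segU U x y -> good_path U x y (fun t => lerp (clamp t) x y).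
Proof.
move=> Uxy; split.
- apply: cont_lerp; contc; exact: (@cont_clamp R R (fun t => t) (@cont_id _)).
- by move=> t; apply: Uxy; rewrite clamp_ge0 clamp_le1.
- by rewrite clamp_lt0 // lerp0.
- by rewrite clamp_gt1 // lerp1.
Qed.

Lemma joined_refl U x : U x -> joined U x x.
Proof. by move=> Ux; exists (fun=> x); split => //; exact: cst_continuous. Qed.

Lemma joined_sym U x y : joined U x y -> joined U y x.
Proof. by move=> [g /good_path_rev]; exists (fun t => g (1 - t)). Qed.

Lemma joined_trans U x y z : joined U x y -> joined U y z -> joined U x z.
Proof. by move=> [g1 h1] [g2 h2]; exists (concat g1 g2); exact: good_path_concat h1 h2. Qed.

Definition loops_null U := forall g, continuous g -> g 1 = g 0 ->
  (forall t : R, 0 <= t <= 1 -> U (g t)) -> homotopic U g (fun=> g 0).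

(* The null-homotopy of the loop [g1 * g2^-1] has a lift on the square, which is
   constant on the three sides mapped to the base point; compare [L1] and [L2]
   with its two halves on the fourth side. *)
Lemma monodromy U (f : P -> P) x y g1 g2 (L1 L2 : R -> R) : loops_null U ->
  (forall (g : R * R -> P), continuous g -> (forall p, U (g p)) -> continuous (fun p => f (g p))) ->
  (forall z, U z -> unitary (f z)) ->
  good_path U x y g1 -> good_path U x y g2 -> continuous L1 -> continuous L2 ->
  (forall t : R, 0 <= t <= 1 -> cis (L1 t) = f (g1 t)) ->
  (forall t : R, 0 <= t <= 1 -> cis (L2 t) = f (g2 t)) ->
  L1 0 = L2 0 -> L1 1 = L2 1.
Proof.
move=> nU cf uf h1 h2 cL1 cL2 HL1 HL2 L0.
have h2' := good_path_rev h2.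
have [cg Ug gx gx'] := good_path_concat h1 h2'.
case: h1 h2 h2' => [c1 U1 e10 e11] [c2 U2 e20 e21] [_ _ r0 r1].
have e : g1 1 = g2 (1 - 0) by rewrite subr0 e11 e21.
have [H [cH UH H1 H2]] := nU _ cg (etrans gx' (esym gx)) (fun t _ => Ug t).
have c01 (t : R) : 0 <= clamp t <= 1 by rewrite clamp_ge0 clamp_le1.
have [||L cL HL] := @lift_square R (fun p => f (H (csq p))).
- apply: (cf (fun p => H (csq p))); first by apply: (cont_comp cH); rewrite /csq; contc.
  by move=> p; apply: UH.
- by move=> p; apply: uf; apply: UH.
have {}HL t s : 0 <= t <= 1 -> 0 <= s <= 1 -> cis (L (t, s)) = f (H (t, s)).
  move=> /andP[t0 t1] /andP[s0 s1].
  by rewrite HL /csq /= !clamp_idem (clamp_id t0 t1) (clamp_id s0 s1).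
have i0 : 0 <= (0 : R) <= 1 by rewrite lexx ler01.
have i1 : 0 <= (1 : R) <= 1 by rewrite lexx ler01.
have k1 : L1 1 - L (1 / 2, 0) = L1 0 - L (0, 0).
  have := @lift_diff R L1 (fun t => L (t / 2, 0)) cL1.
  rewrite mul0r; apply; first by apply: (cont_comp cL); cont.
  move=> t t01; rewrite HL1 // HL //; last by lra.
  rewrite (H1 _ _).1; last by lra.
  rewrite concatE // ifT; last by lra.
  by rewrite mulrC divfK // clamp_id //; lra.
(* The second half of the loop runs along [g2] backwards. *)
have k2 : L2 1 - L (1 / 2, 0) = L2 0 - L (1, 0).
  have := @lift_diff R L2 (fun t => L (1 - t / 2, 0)) cL2.
  rewrite mul0r subr0 (_ : 1 - 1 / 2 = 1 / 2 :> R); last by lra.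
  apply; first by apply: (cont_comp cL); cont.
  move=> t t01; rewrite HL2 // HL //; last by lra.
  rewrite (H1 _ _).1; last by lra.
  rewrite concatE //; case: ifPn => ht.
    have -> : t = 1 by lra.
    by rewrite clamp_gt1 ?e11 ?e21 //; lra.
  by rewrite clamp_id; [congr (f (g2 _)); lra|lra|lra].
have k3 : L (0, 1) - 0 = L (0, 0) - 0.
  rewrite !subr0; apply/eqP; rewrite -subr_eq0; apply/eqP.
  have := @lift_diff R (fun s => L (0, s)) (fun=> L (0, 0)); rewrite subrr; apply.
  - by apply: (@cont_comp R _ _ L (fun s : R => (0 : R, s)) cL); cont.
  - exact: cst_continuous.
  - by move=> s s01; rewrite !HL // (H2 s s01).1 (H2 0 i0).1.
have k4 : L (1, 1) - 0 = L (1, 0) - 0.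
  rewrite !subr0; apply/eqP; rewrite -subr_eq0; apply/eqP.
  have := @lift_diff R (fun s => L (1, s)) (fun=> L (1, 0)); rewrite subrr; apply.
  - by apply: (@cont_comp R _ _ L (fun s : R => (1 : R, s)) cL); cont.
  - exact: cst_continuous.
  - by move=> s s01; rewrite !HL // (H2 s s01).2 (H2 0 i0).2.
have k5 : L (1, 1) - L (0, 1) = 0.
  have := @lift_diff R (fun t => L (t, 1)) (fun=> L (0, 1)); rewrite subrr; apply.
  - by apply: (cont_comp cL); cont.
  - exact: cst_continuous.
  - by move=> t t01; rewrite !HL // (H1 t t01).2 (H1 0 i0).2.
lra.
Qed.

End Paths.

(** * A continuous argument of [z - a] on an open set *)

Section Direction.
Context {R : realType}.
Local Notation P := (R * R)%type.
Implicit Types (U A B : set P) (a z w : P) (g : R -> P).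

Definition dist2 a z := (z.1 - a.1) ^+ 2 + (z.2 - a.2) ^+ 2.

Definition direction a z : P :=
  ((z.1 - a.1) / Num.sqrt (dist2 a z), (z.2 - a.2) / Num.sqrt (dist2 a z)).

Lemma dist2_gt0 a z : z <> a -> 0 < dist2 a z.
Proof.
move=> za; rewrite lt_neqAle addr_ge0 ?sqr_ge0 // andbT eq_sym.
apply/eqP => /eqP; rewrite paddr_eq0 ?sqr_ge0 // !sqrf_eq0 !subr_eq0 => /andP[/eqP h1 /eqP h2].
by apply: za; rewrite (surjective_pairing z) h1 h2 -surjective_pairing.
Qed.

Lemma unitary_direction a z : z <> a -> unitary (direction a z).
Proof.
move=> /dist2_gt0 d0; rewrite /unitary /direction /= !expr_div_n sqr_sqrtr ?ltW //.
by rewrite -mulrDl divff // gt_eqF.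
Qed.

Lemma continuous_direction (T : topologicalType) a (q : T -> P) (x : T) :
  {for x, continuous q} -> q x <> a -> {for x, continuous (fun y => direction a (q y))}.
Proof.
move=> cq /dist2_gt0 d0.
have c1 : (fun y => (q y).1 - a.1) @ x --> (q x).1 - a.1.
  by apply: cvgB; [apply: (cvg_comp _ _ cq); exact: cvg_fst|exact: cvg_cst].
have c2 : (fun y => (q y).2 - a.2) @ x --> (q x).2 - a.2.
  by apply: cvgB; [apply: (cvg_comp _ _ cq); exact: cvg_snd|exact: cvg_cst].
have cd : (fun y => dist2 a (q y)) @ x --> dist2 a (q x).
  by apply: cvgD; rewrite !expr2; apply: cvgM.
have cs : (fun y => (Num.sqrt (dist2 a (q y)))^-1) @ x --> (Num.sqrt (dist2 a (q x)))^-1.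
  apply: cvgV; first by rewrite gt_eqF // sqrtr_gt0.
  by apply: (cvg_comp _ _ cd); exact: sqrt_continuous.
rewrite /continuous_at; apply: (@cvg_pair _ _ _ (nbhs x)
  (nbhs (direction a (q x)).1) (nbhs (direction a (q x)).2)); apply: cvgM.
- exact: c1.
- exact: cs.
- exact: c2.
- exact: cs.
Qed.

Lemma cont_direction (T : topologicalType) a (q : T -> P) :
  continuous q -> (forall x, q x <> a) -> continuous (fun y => direction a (q y)).
Proof. by move=> cq qa x; apply: continuous_direction; [exact: cq|exact: qa]. Qed.

Lemma open_box U z : open U -> U z -> exists2 e : R, 0 < e & forall w, in_box e z w -> U w.
Proof. by move=> oU Uz; apply/nbhs_box; apply: open_nbhs_nbhs. Qed.

Lemma continuous_ratio (T : topologicalType) (q : T -> P) u (x : T) :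
  {for x, continuous q} -> {for x, continuous (fun y => ratio (q y) u)}.
Proof.
move=> cq.
have c1 : (fun y => (q y).1) @ x --> (q x).1 by apply: (cvg_comp _ _ cq); exact: cvg_fst.
have c2 : (fun y => (q y).2) @ x --> (q x).2 by apply: (cvg_comp _ _ cq); exact: cvg_snd.
rewrite /continuous_at; apply: (@cvg_pair _ _ _ (nbhs x)
  (nbhs (ratio (q x) u).1) (nbhs (ratio (q x) u).2)).
  by apply: cvgD; apply: cvgM => //; exact: cvg_cst.
by apply: cvgB; apply: cvgM => //; exact: cvg_cst.
Qed.

Lemma asin0 : asin (0 : R) = 0.
Proof. by rewrite -[X in asin X](@sin0 R) sinK // in_itv /=; have := @pi_ge0 R; lra. Qed.

(** In each path component an argument is fixed at one point and continued along paths; [monodromy]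
    makes the end value independent of the path. *)
Lemma argument_on U a : open U -> loops_null U -> ~ U a ->
  exists theta : P -> R, forall z, U z ->
    cis (theta z) = direction a z /\ {for z, continuous theta}.
Proof.
move=> oU nU nUa.
have Ua z : U z -> z <> a by move=> Uz za; rewrite za in Uz.
(* Points that can be joined choose from the same set and so share one representative. On [U] the
   default [a] is never taken. *)
pose rep z := xget a [set x | joined U x z].
have rep_joined z : U z -> joined U (rep z) z.
  by move=> Uz; apply: (@xgetPex _ a [set x | joined U x z]); exists z; exact: joined_refl.
have rep_eq z w : joined U z w -> rep w = rep z.
  move=> zw; rewrite /rep; congr xget; apply/seteqP; split=> x /= h.
    exact: joined_trans h (joined_sym zw).
  exact: joined_trans h zw.
pose base x := xget 0 [set b | cis b = direction a x].
have cis_base x : U x -> cis (base x) = direction a x.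
  move=> /Ua /unitary_direction /arg_exists h.
  exact: (@xgetPex _ 0 [set b | cis b = direction a x]).
pose is_arg z b := exists g L, [/\ good_path U (rep z) z g, continuous L,
  forall t : R, 0 <= t <= 1 -> cis (L t) = direction a (g t), L 0 = base (rep z) & L 1 = b].
have arg_ex z : U z -> exists b, is_arg z b.
  move=> /rep_joined [g gp]; case: (gp) => cg Ug g0 g1.
  (* A path is lifted as a map of the square that depends on the first coordinate only. *)
  have [||L cL HL] := @lift_square R (fun p => direction a (g p.1)).
  - by apply: cont_direction => [|p]; [apply: (cont_comp cg); cont|exact: Ua].
  - by move=> p; apply: unitary_direction; exact: Ua.
  pose c := base (rep z) - L (0, 0).
  exists (L (1, 0) + c), g, (fun t => L (t, 0) + c); split => //.
  - by cont; apply: (cont_comp cL); cont.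
  - move=> t /andP[t0 t1]; have ut : unitary (direction a (g t)).
      by apply: unitary_direction; exact: Ua.
    apply: (cisD_ratio ut); first by rewrite HL /csq /= clamp_id.
    rewrite ratio_self // /c -ratio_cis cis_base; last by rewrite -g0.
    by rewrite HL /csq /= clamp_id // -g0 ratio_self //; apply: unitary_direction; exact: Ua.
  - by rewrite /c addrC subrK.
have arg_uniq z b b' : is_arg z b -> is_arg z b' -> b = b'.
  move=> [g1 [L1 [gp1 c1 h1 e1 <-]]] [g2 [L2 [gp2 c2 h2 e2 <-]]].
  apply: (monodromy nU _ _ gp1 gp2 c1 c2 h1 h2); last by rewrite e1 e2.
  - by move=> g cg Ug; apply: cont_direction => // p; exact: Ua.
  - by move=> x /Ua; exact: unitary_direction.
pose theta z := xget 0 (is_arg z).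
have thetaP z : U z -> is_arg z (theta z) by move=> /arg_ex; exact: xgetPex.
exists theta => z Uz; have [g [L [gp cL HL L0 L1]]] := thetaP z Uz.
case: (gp) => cg Ug g0 g1.
have i1 : 0 <= (1 : R) <= 1 by rewrite lexx ler01.
split; first by rewrite -L1 HL // g1.
have [e e0 He] : exists2 e : R, 0 < e & forall w, in_box e z w ->
    U w /\ 0 < (ratio (direction a w) (direction a z)).1.
  have [e1 e10 He1] := open_box oU Uz.
  have : nbhs (direction a z) [set w | in_box (1 / 2) (direction a z) w].
    by apply/nbhs_box; exists (1 / 2).
  have cz := @continuous_direction P a id z (@cont_id P z) (Ua z Uz).
  move=> /cz /nbhs_box[e2 e20 He2].
  exists (Num.min e1 e2); first by rewrite lt_min e10.
  move=> w [w1 w2]; rewrite !lt_min in w1 w2.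
  case/andP: w1 => w11 w12; case/andP: w2 => w21 w22.
  have Uw : U w by apply: He1.
  split=> //; apply: ratio_close; [exact/unitary_direction/Ua|exact/unitary_direction/Ua|].
  exact: He2.
(* An explicit local formula for [theta]: the path to [z] is prolonged by the segment to [w], along
   which the quotient of directions stays in the right half-plane. *)
pose th w := theta z + asin (ratio (direction a w) (direction a z)).2.
have uz : unitary (direction a z) by apply/unitary_direction/Ua.
have thE w : in_box e z w -> theta w = th w.
  move=> zw; have seg : segU [set w | in_box e z w] z w.
    by move=> t t01; apply: in_box_lerp => //; exact: in_box_refl.
  have segU' : segU U z w by move=> t /seg /He[].
  have gw := good_path_seg segU'.
  have eg : g 1 = lerp (clamp 0) z w by rewrite g1 clamp_lt0 // lerp0.
  have rw : rep w = rep z by apply: rep_eq; eexists; exact: gw.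
  pose q (t : R) := ratio (direction a (lerp (clamp (2 * t - 1)) z w)) (direction a z).
  have cl : continuous (fun t : R => lerp (clamp (2 * t - 1)) z w) by apply: cont_lerp; contc.
  have c01 (t : R) : 0 <= clamp t <= 1 by rewrite clamp_ge0 clamp_le1.
  have ul (t : R) : unitary (direction a (lerp (clamp (2 * t - 1)) z w)).
    by apply/unitary_direction/Ua/segU'.
  have q0 (t : R) : 0 < (q t).1 by apply: (He _ (seg _ (c01 _))).2.
  have uq (t : R) : unitary (q t) by apply: unitary_ratio.
  apply: (arg_uniq w); first by apply: thetaP; exact: (He w zw).1.
  exists (concat g (fun t => lerp (clamp t) z w)).
  exists (fun t => L (clamp (2 * t)) + asin (q t).2); split.
  - by rewrite rw; exact: good_path_concat gp gw.
  - apply: cont_add; first by apply: (cont_comp cL); contc.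
    move=> t; apply: (@continuous_asin_snd _ _ q t) => //.
    apply: cont_ratio; last exact: cst_continuous.
    by apply: cont_direction => // s; apply: Ua; apply: segU'.
  - move=> t t01; rewrite concatE //; case: ifPn => ht.
      have -> : asin (q t).2 = 0.
        rewrite /q clamp_lt0; last by lra.
        by rewrite lerp0 ratio_self // asin0.
      by rewrite addr0 HL.
    rewrite clamp_gt1; last by lra.
    rewrite L1; apply: (cisD_ratio uz); first by rewrite -L1 HL // g1.
    by rewrite clamp_idem; apply: cis_asin.
  - rewrite /q !mulr0 sub0r [clamp 0]clamp_id ?ler01 // L0 rw clamp_lt0; last by lra.
    by rewrite lerp0 ratio_self // asin0 addr0.
  - rewrite /q !mulr1 [clamp 2]clamp_gt1; last by lra.
    by rewrite L1 clamp_gt1 ?lerp1 //; lra.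
have cth : {for z, continuous th}.
  apply: cvgD; first exact: cvg_cst.
  apply: (@continuous_asin_snd _ _ (fun w => ratio (direction a w) (direction a z)) z).
  - have cz : {for z, continuous (direction a)} :=
      @continuous_direction P a id z (@cont_id P z) (Ua z Uz).
    exact: (@continuous_ratio P (direction a) (direction a z) z cz).
  - exact: unitary_ratio.
  - by rewrite ratio_self // ltr01.
have H : theta @ z --> th z.
  apply: cvg_trans cth; apply: near_eq_cvg; apply/nbhs_box; exists e => // w /thE.
  by move=> ->.
by move: H; rewrite -(thE z (in_box_refl z e0)).
Qed.

End Direction.

(** * Splitting the complement *)

Section NoRetraction.
Context {R : realType}.
Local Notation P := (R * R)%type.
Implicit Types (U A B : set P) (a z w : P).

Definition circle a (r : R) (t : R) : P := (a.1 + r * cos t, a.2 + r * sin t).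

Lemma dist2_circle a r t : dist2 a (circle a r t) = r ^+ 2.
Proof.
rewrite /dist2 /circle /= ![a.1 + _]addrC ![a.2 + _]addrC !addrK !exprMn -mulrDr.
by rewrite cos2Dsin2 mulr1.
Qed.

Lemma direction_circle a r t : 0 < r -> direction a (circle a r t) = cis t.
Proof.
move=> r0; rewrite /direction dist2_circle sqrtr_sqr gtr0_norm // /circle /cis /=.
by rewrite ![a.1 + _]addrC ![a.2 + _]addrC !addrK ![r * _]mulrC !mulfK ?gt_eqF.
Qed.

(** Around the circle of radius [s r], the increase of a lifted argument of [g] does not depend on
    [s]; it is 0 at [s = 0] and would be 2 pi at [s = 1]. *)
Lemma no_retraction a (r : R) (g : P -> P) : 0 < r -> continuous g ->
  (forall z, unitary (g z)) ->
  (forall z, dist2 a z = r ^+ 2 -> g z = direction a z) -> False.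
Proof.
move=> r0 cg ug gE.
pose h (p : R * R) := g (circle a (p.2 * r) (pi *+ 2 * p.1)).
have ch : continuous h.
  rewrite /h; apply: (cont_comp cg); rewrite /circle; cont.
    by apply: (cont_comp (@continuous_cos R)); cont.
  by apply: (cont_comp (@continuous_sin R)); cont.
have [||L cL HL] := @lift_square R h => //; first by move=> p; exact: ug.
have {}HL t s : 0 <= t <= 1 -> 0 <= s <= 1 -> cis (L (t, s)) = h (t, s).
  by move=> /andP[t0 t1] /andP[s0 s1]; rewrite HL /csq /= (clamp_id t0 t1) (clamp_id s0 s1).
have i0 : 0 <= (0 : R) <= 1 by rewrite lexx ler01.
have i1 : 0 <= (1 : R) <= 1 by rewrite lexx ler01.
have k1 : L (1, 1) - pi *+ 2 * 1 = L (0, 1) - pi *+ 2 * 0.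
  apply: (@lift_diff R (fun t => L (t, 1)) (fun t => pi *+ 2 * t)).
  - by apply: (cont_comp cL); cont.
  - by cont.
  - move=> t t01; rewrite HL // /h /= mul1r gE ?dist2_circle //.
    exact: direction_circle.
have k2 : L (1, 1) - L (0, 1) = L (1, 0) - L (0, 0).
  apply: (@lift_diff R (fun s => L (1, s)) (fun s => L (0, s))).
  - by apply: (@cont_comp R _ _ L (fun s : R => (1 : R, s)) cL); cont.
  - by apply: (@cont_comp R _ _ L (fun s : R => (0 : R, s)) cL); cont.
  - move=> s s01; rewrite !HL // /h /= /circle mulr1 mulr0.
    by rewrite cos2pi sin2pi cos0 sin0.
have k3 : L (1, 0) - L (0, 0) = L (0, 0) - L (0, 0).
  apply: (@lift_diff R (fun t => L (t, 0)) (fun=> L (0, 0))).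
  - by apply: (cont_comp cL); cont.
  - exact: cst_continuous.
  - by move=> t t01; rewrite !HL // /h /= /circle !mul0r.
have := @pi_gt0 R; rewrite mulr1 mulr0 in k1; move: k1 k2 k3.
rewrite mulr2n; lra.
Qed.

Lemma cont_dist2 a : continuous (dist2 a).
Proof.
have -> : dist2 a = fun z => (z.1 - a.1) * (z.1 - a.1) + (z.2 - a.2) * (z.2 - a.2).
  by apply/funext => z; rewrite /dist2 !expr2.
by cont.
Qed.

(* If all loops were null-homotopic, [direction a] would have a continuous
   argument [theta] on [U].  Cutting [theta] off near [A] extends [direction a]
   from a large circle to a continuous unitary function on the whole plane. *)
Lemma splits_loops_null U A B : open U -> splits U A B -> ~ loops_null U.
Proof.
move=> oU [cA cB AB0 ABU [[M HM] [a Aa]]] nU.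
have AU z : A z -> ~ U z by move=> Az; rewrite -[~ U z]/((~` U) z) -ABU; left.
have BU z : B z -> ~ U z by move=> Bz; rewrite -[~ U z]/((~` U) z) -ABU; right.
have UAB z : ~ U z -> A z \/ B z by rewrite -[~ U z]/((~` U) z) -ABU.
have nAB z : A z -> ~ B z by move=> Az Bz; have : (A `&` B) z by []; rewrite AB0.
have [theta Hth] := argument_on oU nU (AU a Aa).
have M0 : 0 <= M by have [h _] := HM a Aa; exact: le_trans (normr_ge0 _) h.
(* Since [A] and its point [a] lie in the box of half-side [M], [dist2 a z <= 8 M^2 < r^2] on
   [A]. *)
pose r := 4 * M + 1.
have r0 : 0 < r by rewrite /r; lra.
have Ar z : A z -> dist2 a z < r ^+ 2.
  move=> /HM[]; have [] := HM a Aa; rewrite /dist2 /r !ler_norml.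
  by move=> /andP[? ?] /andP[? ?] /andP[? ?] /andP[? ?]; nra.
pose far : set P := [set z | r ^+ 2 <= dist2 a z].
have cfar : closed far.
  have -> : far = dist2 a @^-1` [set x | r ^+ 2 <= x] by [].
  apply: preimage_closed; last exact: closed_ge.
  by move=> z _; exact: cont_dist2.
have [|f [cf fA fB _]] := @urysohn_ext_itv P R (@pseudometric_normal R P) A (B `|` far) 0 1
  cA (closedU cB cfar) _ ltr01.
  apply/seteqP; split => // z [Az [Bz|fz]]; first by case: (nAB z).
  by have := Ar z Az; rewrite ltNge; move: fz; rewrite /far /= => ->.
have {}fA z : A z -> f z = 0 by move=> Az; apply: fA; exists z.
have {}fB z : B z \/ far z -> f z = 1 by move=> Bz; apply: fB; exists z.
(* The clamp makes the cut-off 0 on a whole neighbourhood of [A] and 1 on a neighbourhood of [B] and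
   [far], not just on these sets. *)
pose chi z := clamp (3 * f z - 1).
have cchi : continuous chi by rewrite /chi; contc.
(* [theta] has a meaning on [U] only. The values on [A] and [B] continue those nearby, where [chi]
   is 0 and 1. *)
pose g z : P := if `[< U z >] then cis (chi z * theta z)
  else if `[< A z >] then (1, 0) else direction a z.
have gU z : U z -> g z = cis (chi z * theta z) by move=> Uz; rewrite /g asboolT.
have gA z : A z -> g z = (1, 0).
  by move=> Az; rewrite /g asboolF ?asboolT //; exact: AU.
have gB z : B z -> g z = direction a z.
  by move=> Bz; rewrite /g asboolF ?asboolF //; [move=> /nAB|exact: BU].
have Ba z : B z -> z <> a by move=> Bz za; apply: (nAB a) => //; rewrite -za.
have gdir z : ~ A z -> chi z = 1 -> g z = direction a z.
  move=> nAz cz; have [Uz|/UAB[//|Bz]] := pselect (U z); last exact: gB.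
  by rewrite gU // cz mul1r; exact: (Hth z Uz).1.
clearbody g.
have near_cvg (g' : P -> P) z : {for z, continuous g'} -> (\forall w \near z, g w = g' w) ->
    {for z, continuous g}.
  move=> cg' gg'; have e : g z = g' z := nbhs_singleton gg'.
  suff : g @ z --> g' z by rewrite -e.
  apply: cvg_trans cg'; apply: near_eq_cvg.
  by apply: filterS gg' => w ->.
apply: (@no_retraction a r g r0).
- move=> z; have [Uz|/UAB[Az|Bz]] := pselect (U z).
  + apply: (near_cvg (fun w => cis (chi w * theta w))); last first.
      by apply: filterS (open_nbhs_nbhs (conj oU Uz)) => w; exact: gU.
    apply: (@continuous_comp _ _ _ (fun w => chi w * theta w) (@cis R)).
      by apply: cvgM; [exact: cchi|exact: (Hth z Uz).2].
    exact: (@cont_cis R R id (@cont_id R)).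
  + apply: (near_cvg (fun=> (1, 0))); first exact: cvg_cst.
    have f3 : \forall w \near z, f w < 1 / 3.
      by apply: (cvgr_lt (f z) (cf z)); rewrite fA //; lra.
    apply: filterS f3 => w fw.
    have cw : chi w = 0 by rewrite /chi clamp_lt0 //; lra.
    have [Uw|/UAB[Aw|Bw]] := pselect (U w); last 2 first.
    * exact: gA.
    * by exfalso; move: fw; rewrite fB; [lra|left].
    by rewrite gU // cw mul0r cis0.
  + apply: (near_cvg (direction a)).
      exact: (@continuous_direction R P a id z (@cont_id P z) (Ba z Bz)).
    have f3 : \forall w \near z, 2 / 3 < f w.
      by apply: (cvgr_gt (f z) (cf z)); rewrite fB; [lra|left].
    apply: filterS f3 => w fw; apply: gdir.
      by move=> Aw; move: fw; rewrite fA //; lra.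
    by rewrite /chi clamp_gt1 //; lra.
- move=> z; have [Uz|/UAB[Az|Bz]] := pselect (U z).
  + by rewrite gU //; exact: unitary_cis.
  + by rewrite gA // -cis0; exact: unitary_cis.
  + by rewrite gB //; apply: unitary_direction; exact: Ba.
- move=> z dz; apply: gdir; first by move=> /Ar; rewrite dz ltxx.
  by rewrite /chi fB; [rewrite clamp_gt1 //; lra|right; rewrite /far /= dz].
Qed.

End NoRetraction.

(** * The complex plane and the sphere *)

Local Open Scope complex_scope.

Section ComplexPlane.
Context {R : realType}.
Local Notation P := (R * R)%type.
Local Notation C := (Cplane R).

Definition toC (p : P) : C := p.1 +i* p.2.
Definition ofC (z : C) : P := (complex.Re z, complex.Im z).

Lemma ofCK : cancel ofC toC.
Proof. by case. Qed.

Lemma toCK : cancel toC ofC.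
Proof. by case. Qed.

Lemma nbhsC_box (z : C) (V : set C) :
  nbhs z V <-> exists2 e : R, 0 < e & forall w, in_box e (ofC z) (ofC w) -> V w.
Proof.
split=> [/nbhs_ballP [[e e'] /= ]|[e e0 H]].
  (* The radius of a ball is a complex number, whose positivity means that its imaginary part is 0
     and its real part positive. Half the real part then serves for both coordinates. *)
  rewrite ltcE /= => /andP[/eqP e'0 e0] H.
  exists (e / 2); first by rewrite divr_gt0.
  move=> [w1 w2]; case: z H => [z1 z2] H [] /=; rewrite !ltr_distl => /andP[? ?] /andP[? ?].
  apply: H; rewrite /ball /= normc_def /= ltcE /= -e'0 eqxx /=.
  rewrite -[ltRHS]ger0_norm ?(ltW e0) // -sqrtr_sqr ltr_sqrt; last by rewrite exprn_gt0.
  nra.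
apply/nbhs_ballP; exists (e%:C); first by rewrite /= ltcE /= eqxx.
move=> [w1 w2] h; apply: H; case: z h => [z1 z2].
rewrite /ball /= normc_def /= ltcE /= eqxx /= => h.
have q (x : R) : x ^+ 2 <= (z1 - w1) ^+ 2 + (z2 - w2) ^+ 2 -> `|x| < e.
  by move=> hx; apply: le_lt_trans h; rewrite -sqrtr_sqr ler_wsqrtr.
by split; rewrite /= distrC; apply: q; rewrite ?lerDl ?lerDr sqr_ge0.
Qed.

Lemma cont_ofC : continuous ofC.
Proof.
move=> z V /nbhs_box[e e0 He]; apply/nbhsC_box; exists e => // w; exact: He.
Qed.

Lemma cont_toC : continuous toC.
Proof.
move=> z V /nbhsC_box[e e0 He]; apply/nbhs_box; exists e => // w h.
by apply: He; rewrite !toCK.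
Qed.

Lemma open_toC (U : set C) : open U -> open (toC @^-1` U).
Proof. by move=> oU; apply: open_comp => // z _; exact: cont_toC. Qed.

Lemma path_in_component (U : set C) x (h : R -> C) : continuous h ->
  (forall t : R, 0 <= t <= 1 -> U (h t)) -> connected_component U x (h 0) ->
  forall t : R, 0 <= t <= 1 -> connected_component U x (h t).
Proof.
move=> ch Uh /same_connected_component -> t t01.
apply: (@connected_component_max _ U (h @` `[0, 1])).
- by exists 0 => //=; rewrite in_itv /= lexx ler01.
- by move=> _ [s /= s01 <-]; apply: Uh; rewrite in_itv in s01.
- apply: connected_continuous_connected; first exact: segment_connected.
  exact: continuous_subspaceT.
- by exists t => //=; rewrite in_itv.
Qed.

(** In an open set, small segments make both the points joined to [y] and the points not joined to
    [y] open; connectedness leaves only the former. *)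
Lemma joined_in_component (U : set C) x y z : open U ->
  connected_component U x y -> connected_component U x z ->
  joined (toC @^-1` U) (ofC y) (ofC z).
Proof.
move=> oU Dy Dz; pose V := toC @^-1` U; have oV : open V := open_toC oU.
pose D := connected_component U x.
have DV w : D w -> V (ofC w) by move=> /connected_component_sub; rewrite /V /= ofCK.
pose O : set C := [set w | joined V (ofC y) (ofC w)].
pose N : set C := [set w | V (ofC w) /\ ~ joined V (ofC y) (ofC w)].
have near_joined w : V (ofC w) -> \forall w' \near w, joined V (ofC w) (ofC w') /\ V (ofC w').
  move=> /(open_box oV)[e e0 He]; apply/nbhsC_box; exists e => // w' ww'; split; last exact: He.
  eexists; apply: good_path_seg => t t01; apply: He.
  by apply: in_box_lerp => //; exact: in_box_refl.
have end_in p q : joined V p q -> V q by move=> [g [_ Vg _ <-]].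
have oO : open O.
  rewrite openE => w Ow; apply: filterS (near_joined w (end_in _ _ Ow)) => w' [h _].
  exact: joined_trans Ow h.
have oN : open N.
  rewrite openE => w [Vw nw]; apply: filterS (near_joined w Vw) => w' [h Vw']; split=> // yw'.
  by apply: nw; exact: joined_trans yw' (joined_sym h).
suff : D `&` O = D by move=> E; have [] : (D `&` O) z by rewrite E.
apply: (@component_connected _ U x).
- by exists y; split=> //; apply: joined_refl; exact: DV.
- by exists O.
- exists (~` N); first exact: open_closedC.
  apply/seteqP; split=> w [Dw h]; split=> //; first by case.
  by apply: contrapT => nw; apply: h; split=> //; exact: DV.
Qed.

Lemma within_clamp (T : topologicalType) (g : R -> T) :
  {within `[0, 1]%classic, continuous g} -> continuous (fun t => g (clamp t)).
Proof.
apply: (@within_retract _ _ _ _ g clamp); last exact: clamp_in.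
exact: (@cont_clamp R R (fun t => t) (@cont_id _)).
Qed.

Lemma within_csq (T : topologicalType) (H : R * R -> T) :
  {within `[0, 1]%classic `*` `[0, 1]%classic, continuous H} ->
  continuous (fun p => H (csq p)).
Proof.
apply: (@within_retract _ _ _ _ H csq); first by rewrite /csq; contc.
by move=> p; split; exact: clamp_in.
Qed.

Lemma simply_connected_component (U : set C) x : open U ->
  loops_null (toC @^-1` U) -> simply_connected R (connected_component U x).
Proof.
move=> oU nU; split=> [y z Dy Dz|y g [cg g0 g1 Dg]].
  have [g [cg Ug g0 g1]] := joined_in_component oU Dy Dz.
  have ctg : continuous (fun t => toC (g t)) by apply: cont_comp => //; exact: cont_toC.
  exists (fun t => toC (g t)); split.
  - exact: continuous_subspaceT.
  - by rewrite g0 ofCK.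
  - by rewrite g1 ofCK.
  - move=> t; rewrite in_itv; apply: (path_in_component ctg) => //.
      by move=> s _; exact: Ug.
    by rewrite g0 ofCK.
pose f t := ofC (g (clamp t)).
have cf : continuous f.
  by apply: cont_comp; [exact: cont_ofC|exact: within_clamp].
have fE (t : R) : 0 <= t <= 1 -> f t = ofC (g t).
  by move=> /andP[t0 t1]; rewrite /f clamp_id.
have i0 : 0 <= (0 : R) <= 1 by rewrite lexx ler01.
have i1 : 0 <= (1 : R) <= 1 by rewrite lexx ler01.
have [||H [cH UH H1 H2]] := nU f cf; first by rewrite !fE // g0 g1.
  move=> t t01; rewrite fE //= ofCK; apply: (@connected_component_sub _ U x).
  by apply: Dg; rewrite in_itv.
have ctH : continuous (fun p => toC (H p)) by apply: cont_comp => //; exact: cont_toC.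
exists (fun p => toC (H p)); split.
- exact: continuous_subspaceT.
- move=> t s; rewrite !in_itv /= => t01 s01.
  (* The homotopy is only known to stay in [U]. The segment from [(0, 0)] to [(t, s)] in the square
     joins its value to the base point within [U], hence within the component. *)
  have := @path_in_component U x (fun u => toC (H (u * t, u * s))) _ _ _ 1 i1.
  rewrite !mul1r; apply.
  + by apply: (cont_comp ctH); cont.
  + by move=> u u01; apply: UH; nra.
  + rewrite !mul0r (H1 0 i0).1 fE // ofCK; apply: Dg.
    by rewrite in_itv.
- by move=> t; rewrite in_itv /= => t01; rewrite (H1 t t01).1 fE // ofCK.
- by move=> t; rewrite in_itv /= => t01; rewrite (H1 t t01).2 fE // ofCK.
- move=> s; rewrite in_itv /= => s01; rewrite (H2 s s01).1 (H2 s s01).2 !fE // !ofCK.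
  by rewrite g0 g1.
Qed.

Lemma loops_null_components (U : set C) :
  (forall x, U x -> simply_connected R (connected_component U x)) ->
  loops_null (toC @^-1` U).
Proof.
move=> sc g cg g01 Ug.
have i0 : 0 <= (0 : R) <= 1 by rewrite lexx ler01.
have i1 : 0 <= (1 : R) <= 1 by rewrite lexx ler01.
have ctg : continuous (fun t => toC (g t)) by apply: cont_comp => //; exact: cont_toC.
have U0 : U (toC (g 0)) by exact: Ug.
have [_ /(_ (toC (g 0)) (fun t => toC (g t)))] := sc _ U0.
case.
  split=> //.
  - exact: continuous_subspaceT.
  - by rewrite g01.
  - move=> t; rewrite in_itv; apply: (path_in_component ctg) => //.
    exact: connected_component_refl.
move=> H [cH UH H0 H1 H2].
exists (fun p => ofC (H (csq p))); split.
- by apply: cont_comp; [exact: cont_ofC|exact: within_csq].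
- move=> t s /andP[t0 t1] /andP[s0 s1]; rewrite /csq /= ofCK !clamp_id //.
  by apply: (@connected_component_sub _ U (toC (g 0))); apply: UH; rewrite in_itv /= ?t0 ?s0.
- move=> t t01; have tI : t \in `[0, 1] by rewrite in_itv.
  case/andP: t01 => t0 t1; rewrite /csq /= (clamp_id t0 t1) !clamp_id ?ler01 //.
  by rewrite H0 // H1 // !toCK.
- move=> s /andP[s0 s1]; rewrite /csq /= !(clamp_id s0 s1) !clamp_id ?ler01 //.
  by have [|-> ->] := H2 s; rewrite ?in_itv /= ?s0 // !toCK g01.
Qed.

Lemma compact_box (A : set P) : closed A -> bounded_box A -> compact A.
Proof.
move=> cA [M HM].
have cI := @segment_compact R (- M) M.
apply: (subclosed_compact cA (compact_setX cI cI)).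
by move=> z /HM[]; rewrite !ler_norml => h1 h2; split; rewrite /= in_itv.
Qed.

Lemma compact_bounded_box (K : set P) : compact K -> bounded_box K.
Proof.
move=> cK; have [z _|e e0 He] := @compact_uniform _ _ K
  (fun e z => `|z.1| < e^-1 /\ `|z.2| < e^-1) cK.
  pose b := `|z.1| + `|z.2| + 1.
  have b0 : 0 < b by rewrite ltr_wpDl // addr_ge0.
  exists b^-1; first by rewrite invr_gt0.
  apply/nbhs_box; exists 1 => // w [w1 w2] r /andP[r0 rb].
  have br : b < r^-1 by rewrite -[b]invrK ltf_pV2 ?posrE ?invr_gt0.
  have n1 := normr_ge0 z.1; have n2 := normr_ge0 z.2.
  split; apply: lt_trans br; rewrite /b.
    have := ler_normD (w.1 - z.1) z.1; rewrite subrK; lra.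
  have := ler_normD (w.2 - z.2) z.2; rewrite subrK; lra.
by exists e^-1 => z /He[h1 h2]; rewrite !ltW.
Qed.

End ComplexPlane.

Local Close Scope complex_scope.
Local Close Scope ring_scope.

(** * Clopen pieces of the complement in the sphere *)

Section Sphere.
Context {R : realType}.
Local Notation P := (R * R)%type.
Local Notation C := (Cplane R).
Local Notation S := (Csphere R).

Definition sphere_complement (U : set C) : set S := ~` (Some @` U).

Lemma sphere_complement_Some (U : set C) z : sphere_complement U (Some z) <-> ~ U z.
Proof.
split=> [h Uz|nUz [w Uw [wz]]]; first by apply: h; exists z.
by apply: nUz; rewrite -wz.
Qed.

Lemma sphere_complement_None (U : set C) : sphere_complement U None.
Proof. by move=> [w _]. Qed.

Lemma preimage_Some_open (O : set S) : open O -> open [set p : P | O (Some (toC p))].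
Proof.
move=> oO; have c : continuous (fun p : P => Some (toC p) : S).
  move=> p; apply: (@continuous_comp P C S toC Some); first exact: cont_toC.
  exact: one_point_compactification_some_continuous.
by apply: (@open_comp P S (fun p => Some (toC p)) O) => // p _; exact: c.
Qed.

(** Being closed and bounded, [A] is compact and so remains closed on the sphere; it misses
    infinity, so it is a proper clopen part. *)
Lemma splits_disconnected (U : set C) A B : splits (toC @^-1` U) A B ->
  ~ connected (sphere_complement U).
Proof.
move=> [cA cB AB0 ABU [bA [a Aa]]] conn.
have UA p : A p -> ~ U (toC p).
  by move=> Ap; rewrite -[~ U _]/((~` (toC @^-1` U)) p) -ABU; left.
have UAB p : ~ U (toC p) -> A p \/ B p.
  by rewrite -[~ U _]/((~` (toC @^-1` U)) p) -ABU.
pose E : set S := Some @` (ofC @^-1` A).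
suff EU : E = sphere_complement U.
  have := @sphere_complement_None U; rewrite -EU.
  by move=> [].
have ES z : E (Some z) <-> A (ofC z).
  by split=> [[w Aw [<-]]|Az] //; exists z.
apply: conn.
- by exists (Some (toC a)); apply/ES; rewrite toCK.
- exists (Some @` (ofC @^-1` (~` B))).
    apply: one_point_compactification_open_some; apply: open_comp; last exact: closed_openC.
    by move=> z _; exact: cont_ofC.
  apply/seteqP; split=> [_ [z Az <-]|x [h [z nBz ze]]].
    split; first by apply/sphere_complement_Some; rewrite -(ofCK z); exact: UA.
    exists z => // Bz; have : (A `&` B) (ofC z) by [].
    by rewrite AB0.
  rewrite -ze in h *; apply/ES.
  have [|//|] := UAB (ofC z); last by move=> /nBz.
  by rewrite ofCK; apply/sphere_complement_Some.
- exists E; last first.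
    apply/seteqP; split=> [_ [z Az <-]|_ []//].
    split; last by exists z.
    by apply/sphere_complement_Some; rewrite -(ofCK z); exact: UA.
  rewrite -[E]setCK; apply: open_closedC; rewrite openE => -[z|] nE.
    have oA : open (ofC @^-1` (~` A)).
      by apply: open_comp; [move=> w _; exact: cont_ofC|exact: closed_openC].
    have nAz : (ofC @^-1` (~` A)) z by move=> Az; apply: nE; apply/ES.
    have H := @one_point_compactification_some_nbhs C z _ (open_nbhs_nbhs (conj oA nAz)).
    apply: (@filterS S (nbhs (Some z : S)) _ _ _ _ H).
    by move=> _ [w nAw <-] /ES.
  have KE : toC @` A = ofC @^-1` A.
    apply/seteqP; split=> [_ [p Ap <-]|w Aw]; first by rewrite /= toCK.
    by exists (ofC w) => //; rewrite ofCK.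
  exists (toC @` A).
    split.
      apply: continuous_compact; last exact: compact_box.
      exact/continuous_subspaceT/cont_toC.
    by rewrite KE; apply: preimage_closed => // w _; exact: cont_ofC.
  rewrite KE => _ [[w nAw <-]|->] //.
  by move=> /ES.
Qed.

Lemma clopen_splits (U : set C) (E O F : set S) : open U -> open O -> closed F ->
  E !=set0 -> E = sphere_complement U `&` O -> E = sphere_complement U `&` F -> ~ E None ->
  exists A B, splits (toC @^-1` U) A B.
Proof.
move=> oU oO cF E0 EO EF nEN.
(* [O] and [F] agree on the complement of [U]; using [F] for one part and the complement of [O] for
   the other makes both closed. *)
exists [set p : P | ~ U (toC p) /\ F (Some (toC p))].
exists [set p : P | ~ U (toC p) /\ ~ O (Some (toC p))].
have OF z : ~ U z -> (O (Some z) <-> F (Some z)).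
  move=> /sphere_complement_Some Sz.
  have [h1 h2] : (sphere_complement U `&` O) (Some z) <-> (sphere_complement U `&` F) (Some z).
    by rewrite -EO -EF.
  by split=> h; [have [] := h1 (conj Sz h)|have [] := h2 (conj Sz h)].
have cU : closed [set p : P | ~ U (toC p)].
  exact/open_closedC/open_toC.
split.
- apply: (closedI cU); have := open_closedC (preimage_Some_open (closed_openC cF)).
  by congr closed; apply/seteqP; split=> p /=; [exact: contrapT|move=> Fp []].
- by apply: (closedI cU); exact: (open_closedC (preimage_Some_open oO)).
- apply/seteqP; split=> // p [[nU Fp] [_ nO]].
  by apply: nO; apply/OF.
- apply/seteqP; split=> [p [[]|[]]//|p nU].
  by have [h|h] := pselect (F (Some (toC p))); [left|right; split=> // Op; apply/h/OF].
split.
  (* As infinity is not in [F], the complement of [F] contains that of a compact set [K], which then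
     bounds the first part. *)
  have nFN : (~` F) None.
    by move=> FN; apply: nEN; rewrite EF; split=> //; exact: sphere_complement_None.
  have /closed_openC := cF; rewrite openE => /(_ _ nFN) [K [cK _] KF].
  have : bounded_box (ofC @` K).
    apply: compact_bounded_box; apply: continuous_compact => //.
    exact/continuous_subspaceT/cont_ofC.
  move=> [M HM]; exists M => p [nU Fp]; apply: HM; exists (toC p); last exact: toCK.
  apply: contrapT => nK; apply: (KF (Some (toC p))) => //; left.
  by exists (toC p).
case: E0 => -[z|//] Ez; exists (ofC z); rewrite /= ofCK.
move: Ez; rewrite EF => -[/sphere_complement_Some nUz Fz]; by split.
Qed.

Lemma connected_sphere_complement (U : set C) : open U ->
  connected (sphere_complement U) <-> forall A B, ~ splits (toC @^-1` U) A B.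
Proof.
move=> oU; split=> [c A B /splits_disconnected //|ns].
move=> E E0 [W oW EW] [F cF EF]; apply: contrapT => nE.
(* Either [E] or the rest of the complement misses infinity, and that one is the bounded piece. *)
have [EN|nEN] := pselect (E None); last first.
  by have [A [B sp]] := clopen_splits oU oW cF E0 EW EF nEN; exact: ns sp.
suff [A [B sp]] : exists A B, splits (toC @^-1` U) A B by exact: ns sp.
apply: (@clopen_splits U (sphere_complement U `\` E) (~` F) (~` W)) => //.
- exact: closed_openC.
- exact: open_closedC.
- apply/set0P/negP => /eqP D0; apply: nE; apply/seteqP; split.
    by rewrite EW => x [].
  by move=> x Sx; apply: contrapT => nEx; have : (sphere_complement U `\` E) x by []; rewrite D0.
- by rewrite EF; apply/seteqP; split=> x [h1 h2]; split=> //; [move=> Fx; apply: h2|case].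
- by rewrite EW; apply/seteqP; split=> x [h1 h2]; split=> //; [move=> Wx; apply: h2|case].
- by case.
Qed.

End Sphere.

Theorem theorem2p6 (R : realType) (A : set (Cplane R -> Cplane R))
    (A_nonempty : A !=set0) (A_countable : countable A)
    (A_transcendental : forall g, A g -> transcendental_entire g) :
  let G := semigroup_generated_by A in
  connected (Julia G `|` [set None] : set (Csphere R)) <->
  ~ (exists D : set (Cplane R),
       component_of (Fatou G) D /\ multiply_connected R D).
Proof.
move=> G; have oF : open (Fatou G) by apply: bigcup_open => U [].
(* Infinity already belongs to [Julia G], the Fatou set being a subset of the plane. *)
have -> : Julia G `|` [set None] = sphere_complement (Fatou G).
  apply/seteqP; split=> [x [//|->]|x]; last by left.
  exact: sphere_complement_None.
rewrite (connected_sphere_complement oF); split.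
  move=> ns [_ [[x Fx ->] []]]; apply: simply_connected_component => //.
  move=> g cg g01 Ug; apply: nonsplit_loop_null => //.
  exact: open_toC.
move=> nD B1 B2 sp; apply: (splits_loops_null (open_toC oF) sp).
apply: loops_null_components => x Fx; apply: contrapT => nsc; apply: nD.
by exists (connected_component (Fatou G) x); split=> //; exists x.
Qed.
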